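(* Let $\underline{\pi}>0$ be such that the generator $f$ satisfies Assumption $\mathbf A_f(\underline\pi)$ and the reference policy $\pi_{\rm ref}$ satisfies Assumption $\mathbf P(\underline\pi)$. Then for all $\theta,\theta'\in\mathbb R^{\mathcal S\times\mathcal A}$, $$\left|v^f_{\theta'}(\rho)-v^f_\theta(\rho)-\left\langle \frac{\partial v^f_\theta(\rho)}{\partial\theta},\theta'-\theta\right\rangle\right|\le \frac{L_f}{2}\|\theta'-\theta\|_2^2,$$ where $$L_f:=\frac{8\omega_f(\gamma\omega_f+(1-\gamma)\kappa_f)}{(1-\gamma)^3}+4\lambda\,\frac{2\gamma^2\omega_f^2 d_f+2\gamma(1-\gamma)\omega_f[\kappa_f d_f+y_f]+(1-\gamma)^2[\omega_f+2\kappa_f y_f]}{(1-\gamma)^3}.$$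
   Context: Setting. $\mathcal S,\mathcal A$ are finite nonempty sets; $\mathcal P(X)$ is the set of probability distributions on a finite set $X$; $\gamma\in(0,1)$; $P(\cdot|s,a)\in\mathcal P(\mathcal S)$ is a transition kernel; $r:\mathcal S\times\mathcal A\to[0,1]$ is a reward; $\rho\in\mathcal P(\mathcal S)$ is an initial distribution; $\lambda>0$ is a temperature. A policy is a map $\pi:\mathcal S\to\mathcal P(\mathcal A)$; $\pi_{\rm ref}$ is a fixed reference policy. $f$ is a strictly convex generator with $f(1)=0$, and for $p,q\in\mathcal P(\mathcal A)$ with $q$ of full support $D^f(p\|q)=\sum_a q(a)f(p(a)/q(a))$ (with $f(0)=\lim_{u\downarrow0}f(u)$). The regularized value is $v^f_\pi(s)=\mathbb E^\pi_s[\sum_{t\ge0}\gamma^t(r(S_t,A_t)-\lambda D^f(\pi(\cdot|S_t)\|\pi_{\rm ref}(\cdot|S_t)))]$ (with $S_0=s$, $A_t\sim\pi(\cdot|S_t)$, $S_{t+1}\sim P(\cdot|S_t,A_t)$) and $v^f_\pi(\rho)=\sum_s\rho(s)v^f_\pi(s)$. For $\theta\in\mathbb R^{\mathcal S\times\mathcal A}$ the $f$-softargmax policy is $\pi^f_\theta(\cdot|s)=\arg\max_{\nu\in\mathcal P(\mathcal A)}\{\langle\nu,\theta(s,\cdot)\rangle-D^f(\nu\|\pi_{\rm ref}(\cdot|s))\}$, and $v^f_\theta:=v^f_{\pi^f_\theta}$. Assumption $\mathbf P(\underline\pi)$: $\pi_{\rm ref}(a|s)>\underline\pi$ for all $(s,a)$.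 Assumption $\mathbf A_f(\underline\pi)$: (i) $f$ is bounded and strictly convex on $[0,1/\underline\pi]$, $f(1)=0$, and $f$ is thrice differentiable on $(0,1/\underline\pi)$; (ii) $\lim_{u\downarrow0}f'(u)=-\infty$ and $\lim_{u\to0}|f'(u)/f''(u)|<\infty$; (iii) there are constants $\omega_f\in[1,\infty)$, $\kappa_f\in(0,\infty)$ with $1/(uf''(u))\le\omega_f$ and $|f'''(u)/f''(u)^2|\le\kappa_f$ for all $u\in[0,1/\underline\pi]$ where these expressions are defined; (iv) there is $\iota_f\in(0,1]$ such that $f''$ is decreasing on $(0,\iota_f]$ and $f''(\iota_f)\ge f''(u)$ for $u\in[\iota_f,1/\underline\pi]$. Constants (values at $\nu(a)=0$ are understood as limits $u\downarrow 0$): $d_f=\max_{s,\nu\in\mathcal P(\mathcal A)}D^f(\nu\|\pi_{\rm ref}(\cdot|s))$ and $y_f=\max_{s,\nu}\sum_a\pi_{\rm ref}(a|s)\,|f'(\nu(a)/\pi_{\rm ref}(a|s))|/f''(\nu(a)/\pi_{\rm ref}(a|s))$. *)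

(* Defs.v *)
From HB Require Import structures.
From mathcomp Require Import all_boot all_order all_algebra.
From mathcomp Require Import all_classical all_reals all_analysis.

Set Implicit Arguments.
Unset Strict Implicit.
Unset Printing Implicit Defensive.

Import Order.TTheory GRing.Theory Num.Theory numFieldNormedType.Exports.

Local Open Scope ring_scope.
Local Open Scope classical_set_scope.

Definition is_dist (R : realType) (X : finType) (p : X -> R) : Prop :=
  (forall x, 0 <= p x) /\ \sum_x p x = 1.

Definition is_policy (R : realType) (S A : finType) (pi : S -> A -> R) : Prop :=
  forall s, is_dist (pi s).

Record mdp (R : realType) (S A : finType) := MDP {
  trans : S -> A -> S -> R;
  reward : S -> A -> R;
  disc : R;
  init : S -> R;
  trans_dist : forall s a, is_dist (trans s a);
  reward_range : forall s a, 0 <= reward s a <= 1;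
  disc_range : 0 < disc < 1;
  init_dist : is_dist init }.

(* [(St t, At t)] are the coordinate processes of the MDP on a common
   measurable space, and [Pr pi s] is the trajectory law usually written P^pi_s:
   it is determined on cylinder events by S_0 = s, A_t ~ pi(.|S_t) and
   S_{t+1} ~ P(.|S_t, A_t).  Such a process always exists, on the path space
   (S * A)^nat, by the Ionescu-Tulcea theorem.  The value of [Pr pi s] when [pi] is not a policy
   is irrelevant. *)
Record trajectory_process (R : realType) (S A : finType) (M : mdp R S A)
    (d : measure_display) (Omega : measurableType d)
    (Pr : (S -> A -> R) -> S -> probability Omega R)
    (St : nat -> Omega -> S) (At : nat -> Omega -> A) : Prop := {
  measurable_state : forall t x, measurable (St t @^-1` [set x]);
  measurable_action : forall t a, measurable (At t @^-1` [set a]);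
  trajectory_law : forall pi s, is_policy pi ->
    forall (n : nat) (x : nat -> S) (a : nat -> A),
      Pr pi s [set w | forall t, (t <= n)%N -> St t w = x t /\ At t w = a t] =
      ((x 0%N == s)%:R * (\prod_(t < n.+1) pi (x t) (a t))
        * \prod_(t < n) trans M (x t) (a t) (x t.+1))%:E }.

Definition fdiv (R : realType) (A : finType) (f : R -> R) (p q : A -> R) : R :=
  \sum_a q a * f (p a / q a).

Definition reg_return (R : realType) (S A : finType) (M : mdp R S A)
    (lam : R) (f : R -> R) (piref pi : S -> A -> R)
    (Omega : Type) (St : nat -> Omega -> S) (At : nat -> Omega -> A)
    (w : Omega) : R :=
  limn (series (fun t => disc M ^+ t *
    (reward M (St t w) (At t w) - lam * fdiv f (pi (St t w)) (piref (St t w))))).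

Definition value (R : realType) (S A : finType) (M : mdp R S A)
    (d : measure_display) (Omega : measurableType d)
    (Pr : (S -> A -> R) -> S -> probability Omega R)
    (St : nat -> Omega -> S) (At : nat -> Omega -> A)
    (lam : R) (f : R -> R) (piref pi : S -> A -> R) (s : S) : R :=
  fine ('E_(Pr pi s)[reg_return M lam f piref pi St At])%E.

Definition value_init (R : realType) (S A : finType) (M : mdp R S A)
    (d : measure_display) (Omega : measurableType d)
    (Pr : (S -> A -> R) -> S -> probability Omega R)
    (St : nat -> Omega -> S) (At : nat -> Omega -> A)
    (lam : R) (f : R -> R) (piref pi : S -> A -> R) : R :=
  \sum_s init M s * value M Pr St At lam f piref pi s.

Definition softargmax_obj (R : realType) (A : finType) (f : R -> R)
    (q th nu : A -> R) : R :=
  \sum_a nu a * th a - fdiv f nu q.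

(* The default [piref s] is only returned if no maximizer exists. *)
Definition softargmax (R : realType) (S A : finType) (f : R -> R)
    (piref theta : S -> A -> R) : S -> A -> R :=
  fun s => xget (piref s) [set nu | is_dist nu /\
    forall mu, is_dist mu ->
      softargmax_obj f (piref s) (theta s) mu
        <= softargmax_obj f (piref s) (theta s) nu].

Definition strictly_convex_on (R : realType) (D : set R) (f : R -> R) : Prop :=
  forall x y t : R, D x -> D y -> x != y -> 0 < t < 1 ->
    f (t * x + (1 - t) * y) < t * f x + (1 - t) * f y.

Definition assumption_P (R : realType) (S A : finType) (pmin : R)
    (piref : S -> A -> R) : Prop :=
  forall s a, pmin < piref s a.

(* Conditions on derivatives are imposed only on the open interval
   ]0, 1/pmin[, where the derivatives are assumed to exist. *)
Record assumption_A (R : realType) (pmin : R) (f : R -> R) (omega kappa : R)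
    : Prop := {
  A_bounded : exists B : R, forall u : R, 0 <= u <= pmin^-1 -> `|f u| <= B;
  A_convex : strictly_convex_on `[0, pmin^-1] f;
  A_norm : f 1 = 0;
  A_diff : forall (u : R) (k : nat), 0 < u < pmin^-1 -> (k < 3)%N ->
    derivable (derive1n k f) u 1;
  A_der0 : derive1 f u @[u --> 0^'+] --> -oo;
  A_ratio0 : cvg (`|derive1 f u / derive1n 2 f u| @[u --> 0^'+]);
  A_omega_range : 1 <= omega;
  A_kappa_range : 0 < kappa;
  A_omega : forall u : R, 0 < u < pmin^-1 -> derive1n 2 f u != 0 ->
    (u * derive1n 2 f u)^-1 <= omega;
  A_kappa : forall u : R, 0 < u < pmin^-1 -> derive1n 2 f u != 0 ->
    `|derive1n 3 f u / derive1n 2 f u ^+ 2| <= kappa;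
  A_iota : exists2 iota : R, 0 < iota <= 1 &
    (forall u v : R, 0 < u -> u <= v -> v <= iota -> derive1n 2 f v <= derive1n 2 f u) /\
    (forall u : R, iota <= u < pmin^-1 -> derive1n 2 f u <= derive1n 2 f iota) }.

(* [|f'| / f''], extended by its limit at 0. *)
Definition der_ratio (R : realType) (f : R -> R) (u : R) : R :=
  if u == 0 then lim ((`|derive1 f v| / derive1n 2 f v) @[v --> 0^'+])
  else `|derive1 f u| / derive1n 2 f u.

(* Under the assumptions of the theorem the suprema in [d_const] and [y_const]
   are maxima, by compactness of the simplex. *)
Definition d_const (R : realType) (S A : finType) (f : R -> R)
    (piref : S -> A -> R) : R :=
  sup [set x | exists s, exists2 nu, is_dist nu & x = fdiv f nu (piref s)].

Definition y_const (R : realType) (S A : finType) (f : R -> R)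
    (piref : S -> A -> R) : R :=
  sup [set x | exists s, exists2 nu, is_dist nu &
    x = \sum_a piref s a * der_ratio f (nu a / piref s a)].

Definition L_const (R : realType) (gam lam omega kappa df yf : R) : R :=
  8 * omega * (gam * omega + (1 - gam) * kappa) / (1 - gam) ^+ 3
  + 4 * lam *
    ((2 * gam ^+ 2 * omega ^+ 2 * df
      + 2 * gam * (1 - gam) * omega * (kappa * df + yf)
      + (1 - gam) ^+ 2 * (omega + 2 * kappa * yf)) / (1 - gam) ^+ 3).

Definition gradient (R : realType) (S A : finType)
    (V : (S -> A -> R) -> R) (theta : S -> A -> R) : S -> A -> R :=
  fun s a =>
    (fun t : R => V (fun s' a' =>
       theta s' a' + t * ((s' == s) && (a' == a))%:R))^`() 0.

Definition inner (R : realType) (S A : finType) (u v : S -> A -> R) : R :=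
  \sum_s \sum_a u s a * v s a.

Definition norm2 (R : realType) (S A : finType) (u : S -> A -> R) : R :=
  Num.sqrt (inner u u).

(* Main.v *)
(* At each state the f-softargmax [nu] is interior, because [f' -> -oo] at 0, and
   satisfies [x a - f' (nu a / q a) = mu].  Comparing two parameters at distance
   [m] and using the mean value theorem for [f'] gives
   [nu' - nu = w (u - mean_w u)] with positive weights [w] of total mass at most
   [2 omega]; since [1 / f''] is [kappa]-Lipschitz, this yields
   [|nu' - nu|_1 <= 2 omega m] and a linearization error of at most
   [4 kappa omega m^2].  The same estimate shows that [nu] is differentiable
   along segments, where the divergence has first derivative at most [2 m y_f]
   and second derivative at most [(omega + 5 kappa y_f) m^2].

   The value is the resolvent [(I - gamma P_pi)^-1] of the mean one-step reward.
   If [l] solves the linearized Bellman equation, the error [v' - v - l] solves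
   a Bellman equation whose source collects these first- and second-order terms,
   so it is at most [L / 2 m^2] in the sup norm.  As [l] is linear in the
   parameter increment, the same bound identifies it with the gradient. *)
Require Import Defs.
From HB Require Import structures.
From mathcomp Require Import all_boot all_order all_algebra.
From mathcomp Require Import all_classical all_reals all_analysis.
From mathcomp Require Import measurable_realfun ring lra.

Set Implicit Arguments.
Unset Strict Implicit.
Unset Printing Implicit Defensive.

Import Order.TTheory GRing.Theory Num.Theory numFieldNormedType.Exports.

Local Open Scope ring_scope.
Local Open Scope classical_set_scope.

(** * Calculus on the real line *)

Lemma is_derive_continuous_at (R : realType) (g : R -> R) (x l : R) :
  is_derive x 1 g l -> {for x, continuous g}.
Proof.
by move=> h; apply/differentiable_continuous/derivable1_diffP; case: h.
Qed.

Lemma mean_value (R : realType) (g dg : R -> R) (lo hi a b : R) :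
  (forall x, lo < x < hi -> is_derive x 1 g (dg x)) ->
  lo < a < hi -> lo < b < hi ->
  exists c, [/\ lo < c < hi, Num.min a b <= c <= Num.max a b &
    g b - g a = dg c * (b - a)].
Proof.
move=> dg_ ha hb.
wlog ab : a b ha hb / a <= b.
  move=> H; case/orP: (le_total a b) => ab; first exact: H.
  have [c [c1 c2 c3]] := H b a hb ha ab.
  exists c; split => //; first by rewrite minC maxC.
  by rewrite -opprB c3 -mulrN opprB.
have inI x : a <= x <= b -> lo < x < hi by lra.
have [c cab ->] : exists2 c, c \in `[a, b]%R & g b - g a = dg c * (b - a).
  apply: MVT_segment => //.
    by move=> x; rewrite in_itv/= => /andP[? ?]; apply: dg_; apply: inI; lra.
  apply: continuous_in_subspaceT => x; rewrite inE/= in_itv/= => xab.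
  exact: is_derive_continuous_at (dg_ _ (inI _ xab)).
move: cab; rewrite in_itv/= => cab.
by exists c; split => //; [exact: inI | rewrite (min_idPl ab) (max_idPr ab)].
Qed.

(** A linearization with quadratic error identifies the derivative. Both the softargmax along a
    segment and the value are differentiated this way. *)
Lemma is_derive_quadratic (R : realType) (g : R -> R) (x l C : R) :
  (forall h, `|g (x + h) - g x - h * l| <= C * h ^+ 2) -> is_derive x 1 g l.
Proof.
move=> H.
have C0 : 0 <= C by have := H 1; have := normr_ge0 (g (x + 1) - g x - 1 * l); lra.
have Hl : h^-1 *: ((g \o shift x) h%:A - g x) @[h --> 0^'] --> l.
  apply/cvgrPdist_le => e e0; near=> h.
  have h0 : h != 0 by near: h; exact: nbhs_dnbhs_neq.
  have hn : 0 < `|h| by rewrite normr_gt0.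
  rewrite /= [_%:A]mulr1 [h + x]addrC -(ler_pM2l hn) -normrM.
  rewrite mulrBr [h * (h^-1 *: _)]mulrA mulfV// mul1r -normrN opprB.
  apply: le_trans (H h) _; rewrite -real_normK ?num_real// expr2 mulrA mulrC.
  rewrite ler_pM2l//; have : `|h| <= e / (C + 1).
    near: h; apply: dnbhs0_le; rewrite divr_gt0//; lra.
  rewrite ler_pdivlMr; nra.
split; first by apply/cvg_ex; exists l.
exact: cvg_lim.
Unshelve. all: by end_near. Qed.

(** Since [dg x] is within [2 * E * x] of [dg 0], the function [g x - dg 0 * x - s * x ^+ 2] has a
    derivative of constant sign on (0, 1) for [s = E] and for [s = - E]. The mean value theorem for
    these two choices gives the two sides of the bound. *)
Lemma taylor2 (R : realType) (g dg ddg : R -> R) (E : R) :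
  (forall x : R, is_derive x 1 g (dg x)) -> (forall x : R, is_derive x 1 dg (ddg x)) ->
  (forall x, `|ddg x| <= 2 * E) -> `|g 1 - g 0 - dg 0| <= E.
Proof.
move=> hg hdg hE.
have E0 : 0 <= E by have := hE 0; have := normr_ge0 (ddg 0); lra.
have lip x : 0 < x -> `|dg x - dg 0| <= 2 * E * x.
  move=> x0.
  have [||c [_ _ ->]] := @mean_value _ dg ddg (-1) (x + 1) 0 x; try lra.
  by rewrite subr0 normrM (gtr0_norm x0) ler_wpM2r// ltW.
pose p (s : R) : R -> R := g - dg 0 *: id - s *: (id ^+ 2).
have pE s x : p s x = g x - dg 0 * x - s * x ^+ 2 by [].
have dp (s x : R) : is_derive x 1 (p s) (dg x - dg 0 - 2 * s * x).
  rewrite /p; apply: is_derive_eq.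
  rewrite /GRing.scale/=; ring.
have key s : exists2 c, 0 < c < 1 & g 1 - dg 0 - s - g 0 = dg c - dg 0 - 2 * s * c.
  have [|c] := @MVT _ (p s) _ 0 1 ltr01 (fun x _ => dp s x).
  - by apply: continuous_subspaceT => x; exact: is_derive_continuous_at (dp s x).
  - rewrite in_itv/= => cI Hc; exists c => //; move: Hc; rewrite !pE; lra.
have [c1 c1I e1] := key E; have [c2 c2I e2] := key (- E).
have := lip c1; have := lip c2; rewrite !ler_norml.
move=> /(_ ltac:(lra)) /andP[h1 h2] /(_ ltac:(lra)) /andP[h3 h4].
apply/andP; split; lra.
Qed.

Lemma cvg_sumr (R : realType) (I : finType) (T : Type) (F : set_system T)
    (FF : Filter F) (u : I -> T -> R) (l : I -> R) :
  (forall i, u i x @[x --> F] --> l i) ->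
  (\sum_i u i x) @[x --> F] --> \sum_i l i.
Proof.
move=> ul.
have H (r : seq I) : (\sum_(i <- r) u i x) @[x --> F] --> \sum_(i <- r) l i.
  elim: r => [|i r IH].
    by rewrite big_nil; under eq_fun do rewrite big_nil; exact: cvg_cst.
  rewrite big_cons; under eq_fun do rewrite big_cons.
  exact: cvgD (ul i) IH.
exact: H.
Qed.

(** * The generator *)

Section Generator.
Context (R : realType) (f : R -> R) (pmin omega kappa : R).
(* Abstract names for the derivatives, so that comparing their values never
   unfolds the limits that define them. *)
Context (g1 g2 g3 : R -> R).
Hypotheses (g1E : g1 = derive1 f) (g2E : g2 = derive1n 2 f)
  (g3E : g3 = derive1n 3 f).
Hypotheses (pmin_gt0 : 0 < pmin) (hA : assumption_A pmin f omega kappa).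

Lemma gen_derive (k : nat) (u : R) : (k < 3)%N -> 0 < u < pmin^-1 ->
  is_derive u 1 (derive1n k f) (derive1n k.+1 f u).
Proof.
move=> k3 hu; rewrite derive1nS derive1E; apply: derivableP.
exact: (A_diff hA).
Qed.

Lemma gen_derive1 (u : R) : 0 < u < pmin^-1 -> is_derive u 1 f (g1 u).
Proof. by rewrite g1E; exact: (@gen_derive 0). Qed.

Lemma gen_derive2 (u : R) : 0 < u < pmin^-1 -> is_derive u 1 g1 (g2 u).
Proof. by rewrite g1E g2E; exact: (@gen_derive 1). Qed.

Lemma gen_derive3 (u : R) : 0 < u < pmin^-1 -> is_derive u 1 g2 (g3 u).
Proof. by rewrite g2E g3E; exact: (@gen_derive 2). Qed.

(** If [g2 u < 0], the Caratheodory slope of [g1] at [u] is negative nearby, so [g1] is at least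
    [g1 u] just left of [u] and at most [g1 u] just right of it. Mean values then give
    [f (u + h) + f (u - h) <= 2 * f u], against strict convexity at the midpoint. *)
Lemma gen_der2_ge0 (u : R) : 0 < u < pmin^-1 -> 0 <= g2 u.
Proof.
move=> hu; rewrite leNgt; apply/negP => f2lt0.
have [g [gE gc gu]] := (is_derive1_caratheodory _ _ _).1 (gen_derive2 hu).
have : \forall z \near u, g z < 0 by apply: (cvgr_lt (g u) gc); rewrite gu.
case/nbhs_ballP => e /= e0 He.
(* This radius keeps [u - h] and [u + h] inside the domain and inside the ball where the slope is
   negative; halving it makes both inclusions strict. *)
pose m := Num.min e (Num.min u (pmin^-1 - u)).
have m0 : 0 < m by rewrite !lt_min; lra.
have [me mu mU] : [/\ m <= e, m <= u & m <= pmin^-1 - u].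
  by split; rewrite !ge_min lexx ?orbT.
pose h := m / 2.
have gneg (z : R) : u - h <= z <= u + h -> g z < 0.
  move=> hz; apply: He; rewrite -ball_normE /= ltr_norml /h in hz *; lra.
have [||c [cI c1 c2]] := mean_value (a := u) (b := u + h) gen_derive1; rewrite /h; try lra.
have [||c' [cI' c1' c2']] := mean_value (a := u) (b := u - h) gen_derive1; rewrite /h; try lra.
have h0 : 0 < h by rewrite /h; lra.
have e1 : f (u + h) - f u <= g1 u * h.
  rewrite -/h min_l ?max_r in c1; try lra.
  have gc' := gneg c ltac:(lra).
  have : g c * (c - u) <= 0 by rewrite mulr_le0_ge0 ?(ltW gc'); lra.
  by rewrite c2 -gE subr_le0 -/h addrAC subrr add0r => /ler_wpM2r -> //; lra.
have e2 : f (u - h) - f u <= - g1 u * h.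
  rewrite -/h min_r ?max_l in c1'; try lra.
  have gc' := gneg c' ltac:(lra).
  have : 0 <= g c' * (c' - u) by rewrite mulr_le0 ?(ltW gc'); lra.
  rewrite c2' -gE subr_ge0 -/h addrAC subrr add0r mulrN mulNr lerN2.
  by move=> /ler_wpM2r -> //; lra.
have := @A_convex _ _ _ _ _ hA (u - h) (u + h) 2^-1.
rewrite /= !in_itv /=; move=> /(_ ltac:(rewrite /h; lra) ltac:(rewrite /h; lra)).
have -> : 2^-1 * (u - h) + (1 - 2^-1) * (u + h) = u by lra.
have neq : u - h != u + h by apply/eqP; lra.
by move=> /(_ neq ltac:(lra)); lra.
Qed.

Lemma gen_omega_ge1 : 1 <= omega.
Proof. exact: A_omega_range hA. Qed.

Lemma gen_kappa_gt0 : 0 < kappa.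
Proof. exact: A_kappa_range hA. Qed.

(* Where [g2] is nonzero it is at least [pmin / omega], so by the intermediate
   value theorem it cannot vanish anywhere unless it vanishes identically to
   the left, which [g1 -> -oo] at 0 excludes. *)
Lemma gen_der2_gt0 (u : R) : 0 < u < pmin^-1 -> 0 < g2 u.
Proof.
move=> hu; rewrite ltNge; apply/negP => f2u.
have [v [hv fv]] : exists v : R, 0 < v < u /\ g1 v < g1 u.
  near (0:R)^'+ => v; exists v; split.
    apply/andP; split; first by near: v; exact: nbhs_right_gt.
    by near: v; apply: nbhs_right_lt; lra.
  by near: v; rewrite g1E; apply: (cvgrNy_lt (A_der0 hA)).
have [||c [cI c1 c2]] := mean_value (a := v) (b := u) gen_derive2; try lra.
move: c1; rewrite min_l ?max_r; try lra; move=> c1.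
have f2c : 0 < g2 c by nra.
have om1 := gen_omega_ge1.
(* The first bound lets the intermediate value theorem reach [y] between [c] and [u]; the second
   gives [x * y * (2 * omega) < 1] for every [x < pmin^-1], while [A_omega] would force
   [1 <= omega * (x * y)]. *)
pose y := Num.min (g2 c) (pmin / (2 * omega)).
have y0 : 0 < y by rewrite lt_min f2c divr_gt0//; lra.
have yc : y <= g2 c by rewrite ge_min lexx.
have yp : y * (2 * omega) <= pmin.
  by rewrite -ler_pdivlMr ?ge_min ?lexx ?orbT//; lra.
have [x xI fx] : exists2 x, x \in `[c, u]%R & g2 x = y.
  apply: IVT; first lra.
    apply: continuous_in_subspaceT => x; rewrite inE/= in_itv/= => xI.
    by apply: is_derive_continuous_at; apply: gen_derive3; lra.
  by rewrite min_r ?max_l; lra.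
move: xI; rewrite in_itv/= => xI.
have := @A_omega _ _ _ _ _ hA x; rewrite -g2E fx => /(_ ltac:(lra) (lt0r_neq0 y0)).
have xy0 : 0 < x * y by apply: mulr_gt0 => //; lra.
rewrite -[_^-1]mul1r ler_pdivrMr// => H.
have : x * (y * (2 * omega)) <= x * pmin by rewrite ler_wpM2l//; lra.
have : x * pmin < 1 by rewrite -ltr_pdivlMr// mul1r; lra.
lra.
Unshelve. all: by end_near. Qed.

Lemma gen_der2V_gt0 (u : R) : 0 < u < pmin^-1 -> 0 < (g2 u)^-1.
Proof. by move=> hu; rewrite invr_gt0 gen_der2_gt0. Qed.

Lemma gen_der2V_le (u : R) : 0 < u < pmin^-1 -> (g2 u)^-1 <= omega * u.
Proof.
move=> hu; have := @A_omega _ _ _ _ _ hA u hu; rewrite -g2E => /(_ (lt0r_neq0 (gen_der2_gt0 hu))).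
by rewrite invfM mulrC ler_pdivrMr//; lra.
Qed.

Lemma gen_der3_le (u : R) : 0 < u < pmin^-1 ->
  `|g3 u / g2 u ^+ 2| <= kappa.
Proof. by move=> hu; rewrite g2E g3E; apply: (A_kappa hA) => //; rewrite -g2E gt_eqF ?gen_der2_gt0. Qed.

Lemma gen_der2V_derive (u : R) : 0 < u < pmin^-1 ->
  is_derive u 1 (fun x => (g2 x)^-1) (- (g3 u / g2 u ^+ 2)).
Proof.
move=> hu; apply: is_derive_eq; first apply: is_deriveV.
- by rewrite gt_eqF ?gen_der2_gt0.
- exact: gen_derive3.
- by rewrite /GRing.scale/= mulNr mulrC.
Qed.

Lemma gen_der2V_lipschitz (u v : R) : 0 < u < pmin^-1 -> 0 < v < pmin^-1 ->
  `|(g2 v)^-1 - (g2 u)^-1| <= kappa * `|v - u|.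
Proof.
move=> hu hv; have [//|//|c [cI _ ->]] := mean_value (a := u) (b := v) gen_der2V_derive.
by rewrite normrM normrN ler_wpM2r// gen_der3_le.
Qed.

Lemma gen_der1_mono (u v : R) : 0 < u -> u <= v -> v < pmin^-1 ->
  g1 u <= g1 v.
Proof.
move=> u0 uv vU.
have [||c [cI _ c2]] := mean_value (a := u) (b := v) gen_derive2; try lra.
have := gen_der2_ge0 cI; nra.
Qed.

Lemma gen_tangent (u : R) : 1 < pmin^-1 -> 0 < u < pmin^-1 ->
  g1 1 * (u - 1) <= f u.
Proof.
move=> U1 hu; have f1 := A_norm hA.
have [||c [cI c1 c2]] := mean_value (a := 1) (b := u) gen_derive1; try lra.
move: c2; rewrite f1 subr0 => ->.
have [u1|u1] := leP u 1; [rewrite (min_idPr u1) (max_idPl u1) in c1|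
  rewrite (min_idPl (ltW u1)) (max_idPr (ltW u1)) in c1].
- have := @gen_der1_mono c 1 ltac:(lra) ltac:(lra) ltac:(lra); nra.
- have := @gen_der1_mono 1 c ltac:(lra) ltac:(lra) ltac:(lra); nra.
Qed.

(** Makes the supremum in [y_const] finite. As [1 / g2 u <= omega * u], it suffices to bound
    [u * |g1 u|]. Where [g1 u >= 0], monotonicity compares it with the value at [T]; where
    [g1 u < 0], the mean value theorem on [[u / 2, u]] and the bound [B] on [f] give [4 * B]. *)
Lemma der_ratio_bounded (T : R) : 0 < T < pmin^-1 ->
  exists B : R, forall u : R, 0 <= u <= T -> `|der_ratio f u| <= B.
Proof.
move=> hT; have [B hB] := A_bounded hA.
have om1 := gen_omega_ge1.
pose C := omega * (4 * B + T * `|g1 T|).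
have ratio (u : R) : 0 < u <= T -> 0 <= `|g1 u| / g2 u <= C.
  move=> hu; have uU : 0 < u < pmin^-1 by lra.
  have f2 := gen_der2_gt0 uU; rewrite divr_ge0 ?(ltW f2)//=.
  have B0 : 0 <= B by have := hB u; have := normr_ge0 (f u); lra.
  apply: (@le_trans _ _ (`|g1 u| * (omega * u))).
    by rewrite ler_wpM2l// gen_der2V_le.
  rewrite mulrCA ler_wpM2l//; first lra.
  have T0 : 0 <= T * `|g1 T| by apply: mulr_ge0 => //; lra.
  have [f1|f1] := leP 0 (g1 u).
    have mono := @gen_der1_mono u T ltac:(lra) ltac:(lra) ltac:(lra).
    rewrite ger0_norm//; have := ler_norm (g1 T) => ?.
    have : g1 u * u <= `|g1 T| * T by apply: ler_pM; lra.
    lra.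
  rewrite ltr0_norm//.
  have [||c [cI c1 c2]] := mean_value (a := u) (b := u / 2) gen_derive1; try lra.
  rewrite min_r ?max_l in c1; try lra.
  have mono := @gen_der1_mono c u ltac:(lra) ltac:(lra) ltac:(lra).
  have := hB u ltac:(lra); have := hB (u / 2) ltac:(lra).
  rewrite !ler_norml => /andP[? ?] /andP[? ?].
  have : - g1 u * u <= - g1 c * u by rewrite ler_wpM2r; lra.
  lra.
have nearT : \forall u \near (0:R)^'+, 0 < u <= T.
  near=> u; apply/andP; split; first by near: u; exact: nbhs_right_gt.
  by near: u; apply: nbhs_right_ltW; lra.
(* The assumption takes the absolute value of the whole quotient, while [der_ratio] takes that of
   the numerator only; they agree near 0 because [g2] is positive there. *)
have cv : cvg (`|g1 u| / g2 u @[u --> 0^'+]).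
  have [l hl] := (cvg_ex _).1 (A_ratio0 hA); rewrite -g1E -g2E in hl; apply/cvg_ex; exists l.
  apply: cvg_trans hl; apply: near_eq_cvg; near=> u.
  have uT : 0 < u <= T by near: u.
  by rewrite normrM (@ger0_norm _ (g2 u)^-1)// ltW// gen_der2V_gt0//; lra.
exists C => u hu; rewrite /der_ratio -g1E -g2E; case: eqVneq => [_|u0].
  rewrite ler_norml; apply/andP; split.
    apply: (@le_trans _ _ 0).
      by rewrite oppr_le0; have := ratio T; lra.
    by apply: limr_ge => //; near=> v; have := ratio v; case/(_ _)/andP => //; near: v.
  by apply: limr_le => //; near=> v; have := ratio v; case/(_ _)/andP => //; near: v.
have := ratio u; have -> : 0 < u <= T by rewrite lt_def u0/=; lra.
by case/(_ isT)/andP => h1 h2; rewrite ger0_norm.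
Unshelve. all: by end_near. Qed.

End Generator.

(** * The f-softargmax: existence and first-order condition *)

Lemma cvg_objective (R : realType) (A : finType) (T : topologicalType) (p : T)
    (e : A -> T -> R) (x q : A -> R) (g : R -> R) :
  (forall a, e a p' @[p' --> p] --> e a p) ->
  (forall a, {for e a p / q a, continuous g}) ->
  (\sum_a (e a p' * x a - q a * g (e a p' / q a))) @[p' --> p] -->
    \sum_a (e a p * x a - q a * g (e a p / q a)).
Proof.
move=> he hg; apply: cvg_sumr => a; apply: cvgB.
  by apply: cvgMr_tmp; exact: he.
apply: cvgMl_tmp; apply: (@cvg_comp _ _ _ (fun p' => e a p' / q a) g).
  by apply: cvgMr_tmp; exact: he.
exact: hg.
Qed.

Section Softargmax.
Context (R : realType) (f : R -> R) (pmin omega kappa : R) (g1 g2 g3 : R -> R).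
Hypotheses (g1E : g1 = derive1 f) (g2E : g2 = derive1n 2 f)
  (g3E : g3 = derive1n 3 f).
Hypotheses (pmin_gt0 : 0 < pmin) (hA : assumption_A pmin f omega kappa).
Hypothesis f_cvg0 : f u @[u --> 0^'+] --> f 0.
Context (A : finType) (q : A -> R).
Hypotheses (q_dist : is_dist q) (q_gt : forall a, pmin < q a).

Lemma dist_le1 (p : A -> R) (a : A) : is_dist p -> p a <= 1.
Proof. by case=> p0 <-; rewrite (bigD1 a)//= lerDl sumr_ge0. Qed.

Lemma ref_gt0 (a : A) : 0 < q a.
Proof. exact: lt_trans (q_gt a). Qed.

Lemma ratio_lt (a : A) (t : R) : t <= 1 -> t / q a < pmin^-1.
Proof.
move=> t1; rewrite ltr_pdivrMr ?ref_gt0// (le_lt_trans t1)//.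
by rewrite mulrC ltr_pdivlMr// mul1r.
Qed.

Lemma ratio_gt0 (a : A) (t : R) : 0 < t -> t <= 1 -> 0 < t / q a < pmin^-1.
Proof. by move=> t0 t1; rewrite divr_gt0 ?ref_gt0//= ratio_lt. Qed.

Lemma one_lt_pminV (a : A) : 1 < pmin^-1.
Proof.
by have := ratio_lt a (dist_le1 a q_dist); rewrite divff// gt_eqF ?ref_gt0.
Qed.

(** Freezing [f] at [f 0] on the negative axis makes it continuous at 0 from both sides, so that the
    objective is continuous at boundary points of the simplex in the full product topology. *)
Definition ext0 (t : R) : R := if t <= 0 then f 0 else f t.

Lemma ext0_continuous (t : R) : t < pmin^-1 -> {for t, continuous ext0}.
Proof.
move=> tU; have [t0|t0|->] := ltgtP t 0.
- have : f 0 @[_ --> t] --> f 0 by exact: cvg_cst.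
  rewrite /prop_for /continuous_at {2}/ext0 (ltW t0); apply: cvg_trans.
  apply: near_eq_cvg; near=> u; rewrite /ext0 ifT// ltW//.
  by near: u; exact: (cvgr_lt t (@cvg_id _ (nbhs t))).
- have := is_derive_continuous_at (gen_derive1 g1E hA (introT andP (conj t0 tU))).
  rewrite /prop_for /continuous_at {2}/ext0 leNgt t0/=; apply: cvg_trans.
  apply: near_eq_cvg; near=> u; rewrite /ext0 leNgt ifF//.
  apply/negbF; near: u; exact: (cvgr_gt t (@cvg_id _ (nbhs t))).
- apply/left_right_continuousP; rewrite {2 4}/ext0 lexx; split.
    have : f 0 @[_ --> (0:R)^'-] --> f 0 by exact: cvg_cst.
    apply: cvg_trans; apply: near_eq_cvg; near=> u; rewrite /ext0 ifT//.
  move: f_cvg0; apply: cvg_trans; apply: near_eq_cvg; near=> u.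
  rewrite /ext0 leNgt ifF//; apply/negbF.
  by near: u; exact: nbhs_right_gt.
Unshelve. all: by end_near. Qed.

Definition obj_term (x : A -> R) (a : A) (t : R) : R := t * x a - q a * f (t / q a).

Lemma softargmax_objE (x nu : A -> R) :
  softargmax_obj f q x nu = \sum_a obj_term x a (nu a).
Proof. by rewrite /softargmax_obj /fdiv -sumrB. Qed.

Definition is_softargmax (x nu : A -> R) := is_dist nu /\
  forall mu, is_dist mu -> softargmax_obj f q x mu <= softargmax_obj f q x nu.

(** The simplex is a closed subset of a cube that is compact by Tychonoff, and the objective written
    with [ext0] is continuous on it and agrees with the original one there. *)
Lemma softargmax_exists (x : A -> R) : exists nu, is_softargmax x nu.
Proof.
pose T := prod_topology (fun _ : A => R).
pose K : set T := [set p | forall a, `[0, 1]%classic (p a)].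
have cK : compact K.
  apply: (@tychonoff A (fun=> R) (fun=> `[0, 1]%classic)) => a.
  exact: segment_compact.
have proj_c (a : A) : continuous (fun p : T => p a).
  exact: (@proj_continuous A (fun=> R) a).
pose tot (p : T) : R := \sum_a p a.
have tot_c : continuous tot.
  move=> p.
  exact: (@cvg_sumr R A T (nbhs p) _ (fun a (p : T) => p a) p (fun a => proj_c a p)).
pose D := K `&` tot @^-1` [set 1].
have cD : compact D.
  apply: compact_closedI => //; apply: closed_comp => [p _|]; first exact: tot_c.
  exact: closed_eq.
have DE (p : A -> R) : D p <-> is_dist p.
  split=> [[hK h1]|hp]; first split => // a.
    by have := hK a; rewrite /= in_itv/= => /andP[].
  split=> [a|]; last by case: hp.
  by rewrite /= in_itv/= dist_le1// andbT; case: hp.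
pose F (p : T) : R := \sum_a (p a * x a - q a * ext0 (p a / q a)).
have Fc : {within D, continuous F}.
  apply: continuous_in_subspaceT => p /set_mem/DE hp.
  exact: (@cvg_objective R A T p (fun a (p : T) => p a) x q ext0
    (fun a => proj_c a p) (fun a => ext0_continuous (ratio_lt a (dist_le1 a hp)))).
have FE (p : A -> R) : is_dist p -> F p = softargmax_obj f q x p.
  move=> hp; rewrite softargmax_objE; apply: eq_bigr => a _.
  rewrite /obj_term /ext0; case: ifP => //.
  have [p0 _] := hp; have qa := ref_gt0 a.
  rewrite pmulr_lle0 ?invr_gt0// => pa0.
  have -> : p a = 0 by apply/eqP; rewrite eq_le pa0 p0.
  by rewrite !mul0r.
have [|nu /[!inE] /DE hnu nu_max] := compact_EVT_max _ cD Fc.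
  by exists q; exact/DE.
exists nu; split=> // mu hmu; rewrite -!FE//; apply: nu_max.
by rewrite inE; exact/DE.
Unshelve. all: by end_near. Qed.

(** * Moving mass between two actions *)

Section Transfer.
Context (nu : A -> R) (a b : A) (e : R).
Hypothesis ab : a != b.

(** Optimality is tested against moving mass [e] from [b] to [a], which preserves the total mass and
    leaves a problem in one real variable. *)
Definition transfer (c : A) : R :=
  if c == a then nu a + e else if c == b then nu b - e else nu c.

Lemma sum_transfer (G : A -> R -> R) :
  \sum_c G c (transfer c) - \sum_c G c (nu c) =
  G a (nu a + e) - G a (nu a) + (G b (nu b - e) - G b (nu b)).
Proof.
have ba : b != a by rewrite eq_sym.
rewrite (bigD1 a)//= (bigD1 b)//= [in X in _ - X](bigD1 a)//=.
rewrite [in X in _ - X](bigD1 b)//= /transfer eqxx (negbTE ba) eqxx.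
under eq_bigr => c /andP[/negbTE -> /negbTE ->] do [].
by lra.
Qed.

Lemma transfer_dist : is_dist nu -> - nu a <= e <= nu b -> is_dist transfer.
Proof.
move=> [nu0 nu1] he; split=> [c|].
  by rewrite /transfer; case: eqP => _; [|case: eqP => _]; rewrite ?nu0//; lra.
have := sum_transfer (fun _ t => t); rewrite nu1; lra.
Qed.

Lemma softargmax_transfer (x : A -> R) : is_softargmax x nu ->
  - nu a <= e <= nu b ->
  obj_term x a (nu a + e) - obj_term x a (nu a) +
  (obj_term x b (nu b - e) - obj_term x b (nu b)) <= 0.
Proof.
move=> [hnu nu_max] he; have := nu_max _ (transfer_dist hnu he).
by rewrite !softargmax_objE -subr_le0 sum_transfer.
Qed.

End Transfer.
End Softargmax.

(** * Interiority and stationarity of the maximizer *)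

Section FirstOrder.
Context (R : realType) (f : R -> R) (pmin omega kappa : R) (g1 g2 g3 : R -> R).
Hypotheses (g1E : g1 = derive1 f) (g2E : g2 = derive1n 2 f)
  (g3E : g3 = derive1n 3 f).
Hypotheses (pmin_gt0 : 0 < pmin) (hA : assumption_A pmin f omega kappa).
Context (A : finType) (q : A -> R).
Hypotheses (q_dist : is_dist q) (q_gt : forall a, pmin < q a).
Hypothesis f_cvg0 : f u @[u --> 0^'+] --> f 0.

Let q_gt0 (a : A) : 0 < q a := ref_gt0 pmin_gt0 q_gt a.

Lemma obj_term_derive (x : A -> R) (a : A) (t : R) : 0 < t < pmin^-1 * q a ->
  is_derive t 1 (obj_term f q x a) (x a - g1 (t / q a)).
Proof.
move=> ht; have qa := q_gt0 a.
have tU : 0 < t / q a < pmin^-1 by rewrite divr_gt0 ?ltr_pdivrMr//; lra.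
have -> : obj_term f q x a = x a *: id - q a *: (f \o ((q a)^-1 *: id)).
  by apply/funext => u; rewrite /obj_term /= mulrC [u / _]mulrC.
have hf : is_derive (((q a)^-1 *: id) t) 1 f (g1 (t / q a)).
  have -> : ((q a)^-1 *: id : R -> R) t = t / q a by rewrite [RHS]mulrC.
  exact: (gen_derive1 g1E hA).
apply: is_derive_eq; rewrite /GRing.scale /=.
by field; rewrite gt_eqF.
Qed.

(** The interval starts at 0, where one-sided continuity of [f] takes the place of a derivative. *)
Lemma mean_value_at0 (T : R) : 0 < T < pmin^-1 ->
  exists2 c, 0 < c < T & f T - f 0 = g1 c * T.
Proof.
move=> hT.
have T0 : 0 < T by lra.
have fd (u : R) : u \in `]0, T[%R -> is_derive u 1 f (g1 u).
  by rewrite in_itv/= => hu; apply: (gen_derive1 g1E hA); lra.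
have [|c] := MVT T0 fd.
- apply/continuous_within_itvP; first lra.
  have fc (u : R) : 0 < u < pmin^-1 -> {for u, continuous f}.
    by move=> hu; exact: is_derive_continuous_at (gen_derive1 g1E hA hu).
  split=> // [u|]; first by rewrite in_itv/= => hu; apply: fc; lra.
  by apply: cvg_at_left_filter; exact: fc.
- by rewrite in_itv/= subr0 => cI e; exists c.
Qed.

Lemma ltr_ratio (a : A) (t : R) : t <= 1 -> t < pmin^-1 * q a.
Proof. by move=> t1; rewrite -ltr_pdivrMr ?q_gt0// (ratio_lt pmin_gt0). Qed.

Lemma obj_term_mean (x : A -> R) (a : A) (s t : R) : 0 < s <= 1 -> 0 < t <= 1 ->
  exists2 c, Num.min s t <= c <= Num.max s t &
    obj_term f q x a t - obj_term f q x a s = (x a - g1 (c / q a)) * (t - s).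
Proof.
move=> hs ht.
have [||c [_ c1 c2]] := mean_value (a := s) (b := t) (@obj_term_derive x a).
- by have := @ltr_ratio a s; lra.
- by have := @ltr_ratio a t; lra.
- by exists c.
Qed.

(** If [nu a = 0], moving a small mass to [a] from an action [b] that carries mass gains at a rate
    that is unbounded, because [g1] tends to minus infinity at 0, while the loss rate at [b] stays
    bounded. *)
Lemma softargmax_gt0 (x nu : A -> R) (a : A) : is_softargmax f q x nu -> 0 < nu a.
Proof.
move=> hnu; have [[nu0 nu1] _] := hnu; rewrite lt_def nu0 andbT; apply/eqP => nua.
have [b nub] : exists b, 0 < nu b.
  apply: contrapT => H; suff : \sum_c nu c = 0 by rewrite nu1; apply/eqP/oner_neq0.
  apply: big1 => c _; apply/eqP; rewrite eq_le nu0 andbT leNgt.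
  by apply/negP => nuc; apply: H; exists c.
have ab : a != b by apply: contraTneq nub => <-; rewrite nua ltxx.
have nub1 : nu b <= 1 by apply: dist_le1.
have [qa qb] := (q_gt0 a, q_gt0 b).
(* At most half of the mass of [b] is moved, so its ratio stays above [m]. The move is profitable as
   soon as [g1] at the receiving ratio is below the threshold [K]. *)
pose m := nu b / 2 / q b; pose K := x a - x b + g1 m.
have [u [hu gu]] : exists u : R, 0 < u < pmin^-1 /\ g1 u < K.
  near (0:R)^'+ => u; exists u; split.
    apply/andP; split; first by near: u; exact: nbhs_right_gt.
    by near: u; apply: nbhs_right_lt; rewrite invr_gt0.
  by near: u; rewrite g1E; apply: (cvgrNy_lt (A_der0 hA)).
pose e := Num.min (nu b / 2) (q a * u).
have e0 : 0 < e.
  rewrite lt_min divr_gt0//=; apply: mulr_gt0 => //; lra.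
have [eb eu] : e <= nu b / 2 /\ e <= q a * u by split; rewrite ge_min lexx ?orbT.
have eqa : 0 < e / q a <= u by rewrite divr_gt0//= ler_pdivrMr// mulrC.
have [|c cI ce] := @mean_value_at0 (e / q a); first lra.
have [||c' c'I ce'] := @obj_term_mean x b (nu b) (nu b - e); try lra.
rewrite min_r ?max_l in c'I; try lra.
have := softargmax_transfer ab hnu (e := e).
rewrite ce' nua oppr0 => /(_ ltac:(lra)).
have -> : obj_term f q x a (0 + e) - obj_term f q x a 0 = e * (x a - g1 c).
  rewrite /obj_term add0r !mul0r sub0r opprK.
  have -> : e * x a - q a * f (e / q a) + q a * f 0 =
    e * x a - q a * (f (e / q a) - f 0) by ring.
  by rewrite ce; field; rewrite gt_eqF.
have gc : g1 c <= g1 u.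
  by apply: (gen_der1_mono g1E g2E hA); lra.
have gc' : g1 m <= g1 (c' / q b).
  have c'm : m <= c' / q b by rewrite /m ler_pM2r ?invr_gt0//; lra.
  have m0 : 0 < m by rewrite !divr_gt0.
  apply: (gen_der1_mono g1E g2E hA) => //.
  by rewrite ltr_pdivrMr// ltr_ratio//; lra.
have -> : e * (x a - g1 c) + (x b - g1 (c' / q b)) * (nu b - e - nu b) =
  e * (K - g1 c + (g1 (c' / q b) - g1 m)) by rewrite /K; ring.
by rewrite pmulr_rle0//; lra.
Unshelve. all: by end_near. Qed.

Lemma softargmax_foc (x nu : A -> R) (a b : A) : is_softargmax f q x nu ->
  x a - g1 (nu a / q a) = x b - g1 (nu b / q b).
Proof.
move=> hnu; have [->//|ab] := eqVneq a b.
have [[nu0 nu1] _] := hnu.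
have [nua nub] := (softargmax_gt0 a hnu, softargmax_gt0 b hnu).
have nuab : nu a + nu b <= 1.
  rewrite -nu1 (bigD1 a)//= (bigD1 b)/= 1?eq_sym// addrA lerDl.
  exact: sumr_ge0.
pose h c := obj_term f q x c.
(* [psi t] is the part of the objective that changes when mass [t] goes from [b] to [a]. Both masses
   are positive, so 0 is an interior maximum and the derivative vanishes there. *)
pose psi := (h a \o (id + cst (nu a))) + (h b \o (cst (nu b) - id)).
have dpsi (t : R) : - nu a < t < nu b ->
  is_derive t 1 psi ((x a - g1 ((t + nu a) / q a)) - (x b - g1 ((nu b - t) / q b))).
  move=> ht.
  have h1 : is_derive ((id + cst (nu a)) t) 1 (h a) (x a - g1 ((t + nu a) / q a)).
    apply: obj_term_derive; apply/andP; split; [|apply: ltr_ratio]; rewrite !fctE /=; lra.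
  have h2 : is_derive ((cst (nu b) - id) t) 1 (h b) (x b - g1 ((nu b - t) / q b)).
    apply: obj_term_derive; apply/andP; split; [|apply: ltr_ratio]; rewrite !fctE /=; lra.
  by apply: is_derive_eq; ring.
pose m := Num.min (nu a) (nu b).
have [ma mb m0] : [/\ m <= nu a, m <= nu b & 0 < m].
  by split; rewrite ?ge_min ?lexx ?orbT// lt_min nua.
have [] := @derive1_at_max _ psi (- m) m 0.
- lra.
- by move=> t; rewrite in_itv/= => ht; have [] := dpsi t ltac:(lra).
- by rewrite in_itv/=; lra.
- move=> t; rewrite in_itv/= => ht.
  have := softargmax_transfer ab hnu (e := t) ltac:(lra).
  rewrite /psi /= -!/(h _) !fctE /= add0r subr0 (addrC t); lra.
- move=> _; have [_ ->] := dpsi 0 ltac:(lra).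
  rewrite add0r subr0; lra.
Qed.

(** The Lagrange multiplier is eliminated by comparing actions pairwise. The sensitivity estimates
    rest on these conditions alone and not on maximality. *)
Definition kkt (x nu : A -> R) := [/\ is_dist nu, forall a, 0 < nu a &
  forall a b, x a - g1 (nu a / q a) = x b - g1 (nu b / q b)].

Lemma softargmax_kkt (x nu : A -> R) : is_softargmax f q x nu -> kkt x nu.
Proof.
move=> h; split; first by case: h.
- by move=> a; exact: softargmax_gt0 h.
- by move=> a b; exact: softargmax_foc.
Qed.

End FirstOrder.

(** * Sensitivity of the f-softargmax *)

Definition wmean (R : realType) (A : finType) (w u : A -> R) : R :=
  (\sum_a w a * u a) / \sum_a w a.

Lemma dist_inhabited (R : realType) (A : finType) (p : A -> R) :
  is_dist p -> exists a : A, True.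
Proof.
move=> [_ p1]; apply: contrapT => H; have := oner_neq0 R.
by rewrite -p1 big1 ?eqxx// => a; case: H; exists a.
Qed.

Lemma sumr_gt0 (R : realType) (A : finType) (w : A -> R) (a : A) :
  (forall a, 0 < w a) -> 0 < \sum_a w a.
Proof.
move=> w0; rewrite (bigD1 a)//= ltr_pwDl// sumr_ge0// => b _; exact: ltW.
Qed.

(** * Weighted means and deviations from them *)

Section WeightedMean.
Context (R : realType) (A : finType) (w u : A -> R) (m : R).
Hypotheses (w_ge0 : forall a, 0 <= w a) (W_gt0 : 0 < \sum_a w a).
Hypothesis u_le : forall a, `|u a| <= m.

Lemma wmean_le : `|wmean w u| <= m.
Proof.
rewrite /wmean normrM normfV (gtr0_norm W_gt0) ler_pdivrMr// mulr_sumr.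
apply: le_trans (ler_norm_sum _ _ _) _; apply: ler_sum => a _.
by rewrite normrM (ger0_norm (w_ge0 a)) mulrC ler_wpM2r.
Qed.

Lemma wmean_dev_le (a : A) : `|u a - wmean w u| <= 2 * m.
Proof.
by apply: le_trans (ler_normB _ _) _; have := wmean_le; have := u_le a; lra.
Qed.

Lemma wmean_center : \sum_a w a * (u a - wmean w u) = 0.
Proof.
under eq_bigr do rewrite mulrBr.
by rewrite sumrB -mulr_suml /wmean mulrCA mulfV ?mulr1 ?subrr// gt_eqF.
Qed.

(** The second moment about 0 is the variance plus the total weight times the squared mean. *)
Lemma wmean_var_le :
  \sum_a w a * (u a - wmean w u) ^+ 2 <= (\sum_a w a) * m ^+ 2.
Proof.
apply: (@le_trans _ _ (\sum_a w a * u a ^+ 2)); last first.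
  rewrite mulr_suml; apply: ler_sum => a _; rewrite ler_wpM2l//.
  by rewrite -[u a ^+ 2]real_normK ?num_real// lerXn2r ?nnegrE// (le_trans _ (u_le a)).
have -> : \sum_a w a * u a ^+ 2 = \sum_a w a * (u a - wmean w u) ^+ 2
    + 2 * wmean w u * (\sum_a w a * (u a - wmean w u))
    + wmean w u ^+ 2 * \sum_a w a.
  by rewrite !mulr_sumr -!big_split/=; apply: eq_bigr => a _; ring.
by rewrite wmean_center mulr0 addr0 lerDl mulr_ge0 ?sqr_ge0// ltW.
Qed.

(** Going through the variance gives the constant 1, where the pointwise bound [wmean_dev_le] would
    give 2. The case [m = 0] is separate because the AM-GM step divides by [m]. *)
Lemma wmean_abs_dev_le :
  \sum_a w a * `|u a - wmean w u| <= (\sum_a w a) * m.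
Proof.
have [a] : exists a : A, True.
  apply: contrapT => H; move: W_gt0.
  by rewrite big1 ?ltxx// => a; case: H; exists a.
move=> _; have m0 : 0 <= m := le_trans (normr_ge0 _) (u_le a).
move: m0; rewrite le_eqVlt => /predU1P[m0|m0].
  rewrite -m0 mulr0 big1// => b _; have := wmean_dev_le b.
  by rewrite -m0 mulr0 normr_le0 => /eqP ->; rewrite normr0 mulr0.
pose d b := u b - wmean w u.
(* AM-GM: [2 |d| <= d^2 / m + m] *)
have amgm (b : A) : w b * `|d b| <= (w b * d b ^+ 2 / m + w b * m) / 2.
  rewrite -mulrA -mulrDr -mulrA ler_wpM2l// -[d b ^+ 2]real_normK ?num_real//.
  have -> : (`|d b| ^+ 2 / m + m) / 2 = (`|d b| ^+ 2 + m ^+ 2) / 2 / m.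
    by field; rewrite gt_eqF.
  by rewrite ler_pdivlMr//; have := sqr_ge0 (`|d b| - m); lra.
apply: le_trans (ler_sum _ (fun b _ => amgm b)) _.
rewrite -mulr_suml big_split/= -!mulr_suml ler_pdivrMr// -/d.
have : (\sum_i w i * d i ^+ 2) / m <= (\sum_a w a) * m.
  by rewrite ler_pdivrMr// -mulrA -expr2; exact: wmean_var_le.
lra.
Qed.

End WeightedMean.

Lemma wmeanD (R : realType) (A : finType) (w u v : A -> R) (k : R) :
  wmean w (fun a => u a + k * v a) = wmean w u + k * wmean w v.
Proof.
rewrite /wmean mulrA -mulrDl mulr_sumr -big_split/=; congr (_ / _).
by apply: eq_bigr => a _; ring.
Qed.

(** * Comparison of the maximizers at two parameters *)

Section TwoPoint.
Context (R : realType) (f : R -> R) (pmin omega kappa : R) (g1 g2 g3 : R -> R).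
Hypotheses (g1E : g1 = derive1 f) (g2E : g2 = derive1n 2 f)
  (g3E : g3 = derive1n 3 f).
Hypotheses (pmin_gt0 : 0 < pmin) (hA : assumption_A pmin f omega kappa).
Context (A : finType) (q : A -> R).
Hypotheses (q_dist : is_dist q) (q_gt : forall a, pmin < q a).
Let q_gt0 (a : A) : 0 < q a := ref_gt0 pmin_gt0 q_gt a.

(* [d nu a = weight a * (d x a - d mu)] along the solutions of the first-order
   condition [x a - f' (nu a / q a) = mu]. *)
Definition weight (nu : A -> R) (a : A) : R := q a / g2 (nu a / q a).

(** The derivative of the softargmax in direction [u]. The derivative of the multiplier has to be
    the weighted mean, since the masses keep summing to 1. *)
Definition dsoftargmax (nu u : A -> R) (a : A) : R :=
  weight nu a * (u a - wmean (weight nu) u).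

Let pos_dist (nu : A -> R) := is_dist nu /\ forall a, 0 < nu a.

Lemma pos_ratio (nu : A -> R) (a : A) : pos_dist nu -> 0 < nu a / q a < pmin^-1.
Proof. by case=> hnu nu0; apply: ratio_gt0 => //; exact: dist_le1. Qed.

Lemma weight_gt0 (nu : A -> R) (a : A) : pos_dist nu -> 0 < weight nu a.
Proof.
move=> hnu; rewrite /weight divr_gt0//.
exact: (gen_der2_gt0 g1E g2E g3E pmin_gt0 hA (pos_ratio a hnu)).
Qed.

Lemma weight_le (nu : A -> R) (a : A) : pos_dist nu -> weight nu a <= omega * nu a.
Proof.
move=> hnu; have := gen_der2V_le g1E g2E g3E pmin_gt0 hA (pos_ratio a hnu).
by rewrite mulrA ler_pdivlMr// mulrC.
Qed.

Lemma sum_weight_gt0 (nu : A -> R) : pos_dist nu -> 0 < \sum_a weight nu a.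
Proof.
by move=> hnu; have [a _] := dist_inhabited q_dist;
  apply: (sumr_gt0 a) => b; exact: weight_gt0.
Qed.

Lemma sum_weight_le (nu : A -> R) : pos_dist nu -> \sum_a weight nu a <= omega.
Proof.
move=> hnu; apply: le_trans (ler_sum _ (fun a _ => weight_le a hnu)) _.
by rewrite -mulr_sumr; have [[_ ->] _] := hnu; rewrite mulr1.
Qed.

Context (x x' nu nu' : A -> R) (m : R).
Hypotheses (hnu : kkt g1 q x nu) (hnu' : kkt g1 q x' nu').
Let u (a : A) := x' a - x a.
Hypothesis u_le : forall a, `|u a| <= m.

Let pd : pos_dist nu. Proof. by case: hnu. Qed.
Let pd' : pos_dist nu'. Proof. by case: hnu'. Qed.

(** An exact finite-difference version of [dsoftargmax]: the weight is [q a / g2 c] at a mean value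
    point [c] of [g1] between the two ratios. The point [c] is at most the sum of the ratios, which
    bounds [w], and no farther from the first ratio than the second one is, which bounds its
    distance to [weight nu]. *)
Lemma two_point : exists w : A -> R, [/\ forall a, 0 < w a,
  forall a, w a <= omega * (nu a + nu' a),
  forall a, `|w a - weight nu a| <= kappa * `|nu' a - nu a| &
  forall a, nu' a - nu a = w a * (u a - wmean w u)].
Proof.
have /choice[c hc] : forall a, exists c, [/\ 0 < c < pmin^-1,
    Num.min (nu a / q a) (nu' a / q a) <= c <= Num.max (nu a / q a) (nu' a / q a) &
    g1 (nu' a / q a) - g1 (nu a / q a) = g2 c * (nu' a / q a - nu a / q a)].
  move=> a; exact: (mean_value (gen_derive2 g1E g2E hA) (pos_ratio a pd) (pos_ratio a pd')).
pose w a := q a / g2 (c a).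
have g2c (a : A) : 0 < g2 (c a).
  by have [cI _ _] := hc a; exact: (gen_der2_gt0 g1E g2E g3E pmin_gt0 hA cI).
have w0 (a : A) : 0 < w a by rewrite divr_gt0.
have step (a : A) : nu' a - nu a = w a * (g1 (nu' a / q a) - g1 (nu a / q a)).
  have [_ _ ->] := hc a; rewrite /w.
  by field; rewrite !gt_eqF// ?q_gt0.
have E (a : A) : g1 (nu' a / q a) - g1 (nu a / q a) = u a - wmean w u.
  have W0 : 0 < \sum_b w b by exact: (sumr_gt0 a).
  (* [del] is the increment of the multiplier, common to all actions; equality of the two total
     masses identifies it with [wmean w u]. *)
  pose del := u a - (g1 (nu' a / q a) - g1 (nu a / q a)).
  have delE (b : A) : g1 (nu' b / q b) - g1 (nu b / q b) = u b - del.
    have [_ _ /(_ a b) e1] := hnu; have [_ _ /(_ a b) e2] := hnu'.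
    by rewrite /del /u; lra.
  have : \sum_b (nu' b - nu b) = 0.
    by rewrite sumrB; have [[_ ->] _] := pd; have [[_ ->] _] := pd'; rewrite subrr.
  under eq_bigr do rewrite step delE mulrBr.
  rewrite sumrB -mulr_suml => /eqP; rewrite subr_eq0 => /eqP H.
  by rewrite delE /wmean H [_ * del]mulrC mulfK// gt_eqF.
have sub (a : A) : `|c a - nu a / q a| <= `|nu' a / q a - nu a / q a| /\
    c a <= (nu a + nu' a) / q a.
  have [cI c1 _] := hc a; have := pos_ratio a pd; have := pos_ratio a pd'.
  rewrite mulrDl; move: c1; set t := nu a / q a; set t' := nu' a / q a.
  have [tt|tt] := leP t t' => c1 ? ?.
    by rewrite !ger0_norm; lra.
  by rewrite ler0_norm ?ltr0_norm; lra.
exists w; split=> // a; last by rewrite step E.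
  have [cI _ _] := hc a; have := gen_der2V_le g1E g2E g3E pmin_gt0 hA cI.
  have [_ cle] := sub a; rewrite /w => h.
  have om := gen_omega_ge1 hA.
  have : q a * (g2 (c a))^-1 <= q a * (omega * ((nu a + nu' a) / q a)).
    rewrite ler_wpM2l ?(ltW (q_gt0 a))//; apply: le_trans h _; rewrite ler_wpM2l//; lra.
  have -> // : q a * (omega * ((nu a + nu' a) / q a)) = omega * (nu a + nu' a).
  by field; rewrite gt_eqF.
have [cI _ _] := hc a; have [cl _] := sub a.
rewrite /w /weight -mulrBr normrM (gtr0_norm (q_gt0 a)).
have := gen_der2V_lipschitz g1E g2E g3E pmin_gt0 hA (pos_ratio a pd) cI.
have k0 := gen_kappa_gt0 hA => h.
have -> : nu' a - nu a = q a * (nu' a / q a - nu a / q a) by field; rewrite gt_eqF.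
rewrite normrM (gtr0_norm (q_gt0 a)) mulrCA ler_wpM2l ?(ltW (q_gt0 a))//.
by apply: le_trans h _; rewrite ler_wpM2l// ltW.
Qed.

Lemma softargmax_lipschitz : \sum_a `|nu' a - nu a| <= 2 * omega * m.
Proof.
have [w [w0 wle _ step]] := two_point; have [a0 _] := dist_inhabited q_dist.
have W0 : 0 < \sum_a w a := sumr_gt0 a0 w0.
have m0 : 0 <= m := le_trans (normr_ge0 _) (u_le a0).
under eq_bigr => a _ do rewrite step normrM (gtr0_norm (w0 a)).
apply: le_trans (wmean_abs_dev_le (fun a => ltW (w0 a)) W0 u_le) _.
rewrite ler_wpM2r//; apply: le_trans (ler_sum _ (fun a _ => wle a)) _.
rewrite -mulr_sumr big_split/=.
by have [[_ ->] _] := pd; have [[_ ->] _] := pd'; lra.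
Qed.

(** Replacing the weights [w] by [weight nu] and then the mean [s] by [r] costs at most [S] each
    time. Since [|w a - weight nu a| <= kappa * |nu' a - nu a| = kappa * w a * |u a - s|], the sum
    [S] is at most [kappa] times a variance whose weights have mass at most [2 * omega]. *)
Lemma softargmax_linearize :
  \sum_a `|nu' a - nu a - dsoftargmax nu u a| <= 4 * kappa * omega * m ^+ 2.
Proof.
have [w [w0 wle wlip step]] := two_point; have [a0 _] := dist_inhabited q_dist.
have k0 := gen_kappa_gt0 hA.
have W0 : 0 < \sum_a w a := sumr_gt0 a0 w0.
have V0 := sum_weight_gt0 pd.
set V := \sum_a weight nu a in V0.
pose s := wmean w u; pose r := wmean (weight nu) u.
pose S := \sum_a `|w a - weight nu a| * `|u a - s|.
(* Subtract the two centering identities, one for each system of weights. *)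
have sr : V * (s - r) = \sum_a (w a - weight nu a) * (u a - s).
  have := wmean_center u W0; have := wmean_center u V0; rewrite -/s -/r.
  under eq_bigr do rewrite mulrBr; rewrite sumrB -mulr_suml -/V => e1 e2.
  under [RHS]eq_bigr do rewrite mulrBl; rewrite sumrB e2.
  under [in RHS]eq_bigr do rewrite mulrBr; rewrite sumrB -mulr_suml -/V; lra.
have srle : V * `|s - r| <= S.
  rewrite -{1}(gtr0_norm V0) -normrM sr; apply: le_trans (ler_norm_sum _ _ _) _.
  by under eq_bigr do rewrite normrM.
have Sle : S <= kappa * (2 * omega * m ^+ 2).
  apply: (@le_trans _ _ (kappa * \sum_a w a * (u a - s) ^+ 2)).
    rewrite /S mulr_sumr; apply: ler_sum => a _.
    apply: le_trans (ler_wpM2r (normr_ge0 _) (wlip a)) _.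
    rewrite step normrM (gtr0_norm (w0 a)) -/s -!mulrA -expr2 real_normK ?num_real//.
  rewrite ler_wpM2l ?(ltW k0)//.
  apply: le_trans (wmean_var_le (fun a => ltW (w0 a)) W0 u_le) _.
  rewrite ler_wpM2r ?sqr_ge0//; apply: le_trans (ler_sum _ (fun a _ => wle a)) _.
  rewrite -mulr_sumr big_split/=.
  by have [[_ ->] _] := pd; have [[_ ->] _] := pd'; lra.
apply: (@le_trans _ _ (S + V * `|s - r|)); last by lra.
rewrite /S /V mulr_suml -big_split/=; apply: ler_sum => a _.
have -> : nu' a - nu a - dsoftargmax nu u a =
    (w a - weight nu a) * (u a - s) - weight nu a * (s - r).
  by rewrite step /dsoftargmax -/s -/r; ring.
rewrite -normrM; apply: le_trans (ler_normB _ _) _.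
by rewrite lerD2l normrM (gtr0_norm (weight_gt0 a pd)).
Qed.

End TwoPoint.

(** * The divergence along a segment of parameters *)

Section PointwiseDerive.
Context (R : realType) (x : R).

Lemma is_derive_fun_mul (F G : R -> R) (dF dG : R) :
  is_derive x 1 F dF -> is_derive x 1 G dG ->
  is_derive x 1 (fun t => F t * G t) (dF * G x + F x * dG).
Proof.
move=> hF hG; have h := is_deriveM hF hG.
by apply: (is_derive_eq h); rewrite /GRing.scale/=; ring.
Qed.

Lemma is_derive_fun_mulr (F : R -> R) (dF c : R) :
  is_derive x 1 F dF -> is_derive x 1 (fun t => F t * c) (dF * c).
Proof.
move=> hF; have h := is_derive_fun_mul hF (is_derive_cst c x 1).
by apply: (is_derive_eq h); rewrite mulr0 addr0.
Qed.

Lemma is_derive_fun_mull (F : R -> R) (dF c : R) :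
  is_derive x 1 F dF -> is_derive x 1 (fun t => c * F t) (c * dF).
Proof.
move=> hF; have h := is_derive_fun_mul (is_derive_cst c x 1) hF.
by apply: (is_derive_eq h); rewrite mul0r add0r.
Qed.

Lemma is_derive_fun_subl (G : R -> R) (c dG : R) :
  is_derive x 1 G dG -> is_derive x 1 (fun t => c - G t) (- dG).
Proof.
move=> hG; have h := is_deriveB (is_derive_cst c x 1) hG.
by apply: (is_derive_eq h); rewrite sub0r.
Qed.

Lemma is_derive_fun_sum (I : finType) (F : I -> R -> R) (dF : I -> R) :
  (forall i, is_derive x 1 (F i) (dF i)) ->
  is_derive x 1 (fun t => \sum_i F i t) (\sum_i dF i).
Proof.
move=> hF.
have H (r : seq I) : is_derive x 1 (fun t => \sum_(i <- r) F i t) (\sum_(i <- r) dF i).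
  elim: r => [|i r IH].
    rewrite big_nil (_ : (fun _ => _) = cst 0).
      exact: is_derive_cst.
    by apply/funext => t; rewrite big_nil.
  rewrite big_cons (_ : (fun _ => _) = F i + (fun t => \sum_(j <- r) F j t)).
    exact: is_deriveD.
  by apply/funext => t; rewrite big_cons.
exact: H.
Qed.

End PointwiseDerive.

Lemma wmeanZ (R : realType) (A : finType) (w u : A -> R) (k : R) :
  wmean w (fun a => k * u a) = k * wmean w u.
Proof.
rewrite /wmean mulrA mulr_sumr; congr (_ / _).
by apply: eq_bigr => a _; rewrite mulrCA.
Qed.

Lemma dsoftargmaxD (R : realType) (A : finType) (g2 : R -> R) (q nu u v : A -> R)
    (k : R) (a : A) :
  dsoftargmax g2 q nu (fun b => u b + k * v b) a =
  dsoftargmax g2 q nu u a + k * dsoftargmax g2 q nu v a.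
Proof. by rewrite /dsoftargmax wmeanD; ring. Qed.

Lemma dsoftargmaxZ (R : realType) (A : finType) (g2 : R -> R) (q nu u : A -> R)
    (k : R) (a : A) :
  dsoftargmax g2 q nu (fun b => k * u b) a = k * dsoftargmax g2 q nu u a.
Proof. by rewrite /dsoftargmax wmeanZ; ring. Qed.

Section Path.
Context (R : realType) (f : R -> R) (pmin omega kappa : R) (g1 g2 g3 : R -> R).
Hypotheses (g1E : g1 = derive1 f) (g2E : g2 = derive1n 2 f)
  (g3E : g3 = derive1n 3 f).
Hypotheses (pmin_gt0 : 0 < pmin) (hA : assumption_A pmin f omega kappa).
Context (A : finType) (q : A -> R).
Hypotheses (q_dist : is_dist q) (q_gt : forall a, pmin < q a).
Let q_gt0 (a : A) : 0 < q a := ref_gt0 pmin_gt0 q_gt a.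

Context (Y : R).
Hypothesis Y_ge : forall nu : A -> R, is_dist nu -> (forall a, 0 < nu a) ->
  \sum_a q a * (`|g1 (nu a / q a)| / g2 (nu a / q a)) <= Y.

Context (x u : A -> R) (m : R) (nu : R -> A -> R).
Hypothesis u_le : forall a, `|u a| <= m.
Hypothesis nu_kkt : forall al : R, kkt g1 q (fun a => x a + al * u a) (nu al).

Local Notation w al := (weight g2 q (nu al)).
Local Notation ubar al := (wmean (w al) u).
Local Notation nudot al := (dsoftargmax g2 q (nu al) u).

Let nu_pos (al : R) : is_dist (nu al) /\ forall a, 0 < nu al a.
Proof. by case: (nu_kkt al). Qed.

Let tI (al : R) (a : A) : 0 < nu al a / q a < pmin^-1.
Proof. exact: (pos_ratio pmin_gt0 q_gt a (nu_pos al)). Qed.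

Let w_gt0 (al : R) (a : A) : 0 < w al a.
Proof. exact: (weight_gt0 g1E g2E g3E pmin_gt0 hA q_gt a (nu_pos al)). Qed.

Let W_gt0 (al : R) : 0 < \sum_a w al a.
Proof. exact: (sum_weight_gt0 g1E g2E g3E pmin_gt0 hA q_dist q_gt (nu_pos al)). Qed.

Let W_le (al : R) : \sum_a w al a <= omega.
Proof. exact: (sum_weight_le g1E g2E g3E pmin_gt0 hA q_gt (nu_pos al)). Qed.

Let kappa_gt0 : 0 < kappa := gen_kappa_gt0 hA.

Let m_ge0 : 0 <= m.
Proof. by have [a _] := dist_inhabited q_dist; apply: le_trans (u_le a). Qed.

(** Moving from [al] to [al + h] changes the parameter by [h * u], so the linearization error is of
    order [h ^+ 2]. *)
Lemma path_derive (al : R) (a : A) : is_derive al 1 (fun be => nu be a) (nudot al a).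
Proof.
apply: (@is_derive_quadratic _ _ _ _ (4 * kappa * omega * m ^+ 2)) => h.
have hu (b : A) : `|(x b + (al + h) * u b) - (x b + al * u b)| <= `|h| * m.
  have -> : (x b + (al + h) * u b) - (x b + al * u b) = h * u b by ring.
  by rewrite normrM ler_wpM2l.
have := softargmax_linearize g1E g2E g3E pmin_gt0 hA q_dist q_gt (nu_kkt al)
  (nu_kkt (al + h)) hu.
rewrite exprMn real_normK ?num_real// [h ^+ 2 * _]mulrC mulrA; apply: le_trans.
rewrite (bigD1 a)//= ler_wpDr ?sumr_ge0//.
have -> : (fun b => x b + (al + h) * u b - (x b + al * u b)) = (fun b => h * u b).
  by apply/funext => b; ring.
by rewrite dsoftargmaxZ.
Qed.

Definition wdot (al : R) (a : A) : R :=
  - (g3 (nu al a / q a) / g2 (nu al a / q a) ^+ 2) * nudot al a.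

Lemma ratio_derive (al : R) (a : A) :
  is_derive al 1 (fun be => nu be a / q a) (nudot al a / q a).
Proof. exact: is_derive_fun_mulr (path_derive al a). Qed.

Lemma weight_derive (al : R) (a : A) : is_derive al 1 (fun be => w be a) (wdot al a).
Proof.
have h1 := gen_der2V_derive g1E g2E g3E pmin_gt0 hA (tI al a).
have h := is_derive_fun_mull (q a)
  (@is_derive1_comp _ _ (fun be => nu be a / q a) _ _ _ h1 (ratio_derive al a)).
have g20 := gen_der2_gt0 g1E g2E g3E pmin_gt0 hA (tI al a).
apply: (is_derive_eq h); rewrite /wdot; have q0 := q_gt0 a.
by field; rewrite !gt_eqF.
Qed.

Lemma wdot_le (al : R) (a : A) :
  `|wdot al a| <= kappa * (w al a * `|u a - ubar al|).
Proof.
rewrite /wdot normrM normrN /dsoftargmax [`|w al a * _|]normrM (gtr0_norm (w_gt0 al a)).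
rewrite ler_wpM2r//; first by apply: mulr_ge0 => //; exact: ltW.
exact: (gen_der3_le g1E g2E g3E pmin_gt0 hA (tI al a)).
Qed.

(** The quotient rule for the weighted mean, with both of its terms gathered into deviations from
    the mean. *)
Definition ubardot (al : R) : R :=
  (\sum_a wdot al a * (u a - ubar al)) / \sum_a w al a.

Lemma ubar_derive (al : R) : is_derive al 1 (fun be => ubar be) (ubardot al).
Proof.
have W0 : \sum_a w al a != 0 by rewrite gt_eqF.
have hN := is_derive_fun_sum (fun a => is_derive_fun_mulr (u a) (weight_derive al a)).
have hW := is_derive_fun_sum (fun a => weight_derive al a).
have h := is_derive_fun_mul hN (is_deriveV W0 hW).
apply: (is_derive_eq h); rewrite /ubardot.
under [\sum_a wdot al a * (u a - _)]eq_bigr do rewrite mulrBr.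
rewrite sumrB -mulr_suml /wmean /GRing.scale/=.
by field.
Qed.

(** By [wdot_le] the numerator is at most [kappa] times the weighted variance, and the total weight
    in the variance bound cancels the denominator. *)
Lemma ubardot_le (al : R) : `|ubardot al| <= kappa * m ^+ 2.
Proof.
rewrite /ubardot normrM normfV (gtr0_norm (W_gt0 al)) ler_pdivrMr//.
apply: le_trans (ler_norm_sum _ _ _) _.
have := wmean_var_le (fun a => ltW (w_gt0 al a)) (W_gt0 al) u_le.
move=> /(ler_wpM2l (ltW kappa_gt0)); rewrite [_ * m ^+ 2]mulrC mulrA.
apply: le_trans; rewrite mulr_sumr; apply: ler_sum => a _.
rewrite normrM; apply: le_trans (ler_wpM2r (normr_ge0 _) (wdot_le al a)) _.
by rewrite -!mulrA -expr2 real_normK ?num_real.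
Qed.

Definition ddiv (al : R) : R := \sum_a g1 (nu al a / q a) * nudot al a.

Lemma div_derive (al : R) : is_derive al 1 (fun be => fdiv f (nu be) q) (ddiv al).
Proof.
apply: is_derive_fun_sum => a.
have h1 := gen_derive1 g1E hA (tI al a).
have h := is_derive_fun_mull (q a)
  (@is_derive1_comp _ _ (fun be => nu be a / q a) _ _ _ h1 (ratio_derive al a)).
have q0 := q_gt0 a.
by apply: (is_derive_eq h); field; rewrite !gt_eqF.
Qed.

(** In the first term the factor [g2] from differentiating [g1] has cancelled against the weight
    [q a / g2]. *)
Definition dddiv (al : R) : R := \sum_a (nudot al a * (u a - ubar al)
  + g1 (nu al a / q a) * wdot al a * (u a - ubar al)
  - g1 (nu al a / q a) * w al a * ubardot al).

Lemma ddiv_derive (al : R) : is_derive al 1 ddiv (dddiv al).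
Proof.
apply: is_derive_fun_sum => a.
have h1 := gen_derive2 g1E g2E hA (tI al a).
have h2 := @is_derive1_comp _ _ (fun be => nu be a / q a) _ _ _ h1 (ratio_derive al a).
have h3 := is_derive_fun_mul (weight_derive al a)
  (is_derive_fun_subl (u a) (ubar_derive al)).
have h := is_derive_fun_mul h2 h3.
apply: (is_derive_eq h) => /=.
have := gen_der2_gt0 g1E g2E g3E pmin_gt0 hA (tI al a).
rewrite /dsoftargmax /weight; have := q_gt0 a; move=> q0 g20.
by field; rewrite !gt_eqF.
Qed.

Let der1_weight_le (al : R) :
  \sum_a `|g1 (nu al a / q a)| * w al a <= Y.
Proof.
have [hd h0] := nu_pos al; apply: le_trans (Y_ge hd h0).
by apply: ler_sum => a _; rewrite /weight mulrCA.
Qed.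

Lemma ddiv_le (al : R) : `|ddiv al| <= 2 * m * Y.
Proof.
rewrite /ddiv; apply: le_trans (ler_norm_sum _ _ _) _.
apply: (@le_trans _ _ (2 * m * \sum_a `|g1 (nu al a / q a)| * w al a)); last first.
  by rewrite ler_wpM2l ?mulr_ge0.
rewrite mulr_sumr; apply: ler_sum => a _.
rewrite normrM /dsoftargmax [`|w al a * _|]normrM (gtr0_norm (w_gt0 al a)).
rewrite mulrA mulrC ler_wpM2r//.
  by apply: mulr_ge0 => //; exact: ltW.
exact: (wmean_dev_le (fun a => ltW (w_gt0 al a))).
Qed.

(** The first term is a variance, at most [omega * m ^+ 2]. The second has two deviation factors of
    size [2 * m], giving [4 * kappa * Y]; the third adds one more [kappa * Y] through
    [ubardot_le]. *)
Lemma dddiv_le (al : R) : `|dddiv al| <= (omega + 5 * kappa * Y) * m ^+ 2.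
Proof.
have dev (a : A) : `|u a - ubar al| <= 2 * m.
  exact: (wmean_dev_le (fun a => ltW (w_gt0 al a))).
have var := wmean_var_le (fun a => ltW (w_gt0 al a)) (W_gt0 al) u_le.
rewrite /dddiv sumrB big_split/= -mulr_suml.
apply: le_trans (ler_normB _ _) _.
apply: (@le_trans _ _ (omega * m ^+ 2 + kappa * (4 * m ^+ 2) * Y + Y * (kappa * m ^+ 2)));
  last by lra.
apply: lerD; [apply: le_trans (ler_normD _ _) _; apply: lerD|].
- rewrite ger0_norm; last first.
    apply: sumr_ge0 => a _; rewrite /dsoftargmax -mulrA -expr2.
    by rewrite mulr_ge0 ?sqr_ge0// ltW.
  under eq_bigr do rewrite /dsoftargmax -mulrA -expr2.
  apply: le_trans var _; rewrite ler_wpM2r ?sqr_ge0//.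
- apply: le_trans (ler_norm_sum _ _ _) _.
  apply: (@le_trans _ _ (kappa * (4 * m ^+ 2) * \sum_a `|g1 (nu al a / q a)| * w al a)).
    rewrite mulr_sumr; apply: ler_sum => a _.
    rewrite (normrM _ (u a - ubar al)) (normrM _ (wdot al a)).
    have k1 : `|u a - ubar al| ^+ 2 <= 4 * m ^+ 2.
      rewrite (_ : 4 * m ^+ 2 = (2 * m) ^+ 2); last by ring.
      by rewrite lerXn2r ?nnegrE// mulr_ge0.
    have k2 := ler_wpM2r (normr_ge0 (u a - ubar al)) (wdot_le al a).
    rewrite -mulrA; apply: le_trans (ler_wpM2l (normr_ge0 _) k2) _.
    have w0 := ltW (w_gt0 al a).
    have g0 := normr_ge0 (g1 (nu al a / q a)).
    have := ler_wpM2l (mulr_ge0 (mulr_ge0 (ltW kappa_gt0) g0) w0) k1.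
    by rewrite expr2; lra.
  rewrite ler_wpM2l//; apply: mulr_ge0; first exact: ltW.
  by rewrite mulr_ge0 ?sqr_ge0.
- rewrite normrM; apply: ler_pM => //; last exact: ubardot_le.
  apply: le_trans (ler_norm_sum _ _ _) _.
  under eq_bigr => a _ do rewrite normrM (gtr0_norm (w_gt0 al a)).
  exact: der1_weight_le.
Qed.

Lemma div_lipschitz : `|fdiv f (nu 1) q - fdiv f (nu 0) q| <= 2 * m * Y.
Proof.
have [||c [_ _ ->]] := mean_value (lo := -1) (hi := 2) (a := 0) (b := 1)
  (fun al _ => div_derive al); try lra.
by rewrite subr0 mulr1 ddiv_le.
Qed.

Lemma div_linearize :
  `|fdiv f (nu 1) q - fdiv f (nu 0) q
    - \sum_a g1 (nu 0 a / q a) * dsoftargmax g2 q (nu 0) u a|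
  <= (omega + 5 * kappa * Y) / 2 * m ^+ 2.
Proof.
apply: (taylor2 div_derive ddiv_derive) => al.
by apply: le_trans (dddiv_le al) _; lra.
Qed.

End Path.

(** * Discounted resolvents *)

Section Resolvent.
Context (R : realType) (S : finType) (gam : R) (P : S -> S -> R).
Hypotheses (gam_range : 0 < gam < 1) (P_dist : forall s, is_dist (P s)).

Let gam_gt0 : 0 < gam. Proof. by case/andP: gam_range. Qed.
Let gam_lt1 : `|gam| < 1. Proof. by rewrite gtr0_norm//; case/andP: gam_range. Qed.

Definition app (h : S -> R) (s : S) : R := \sum_y P s y * h y.

Definition resolvent (h : S -> R) (s : S) : R :=
  limn (series (fun t => gam ^+ t * iter t app h s)).

Lemma app_le (h : S -> R) (k : R) (s : S) :
  (forall y, `|h y| <= k) -> `|app h s| <= k.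
Proof.
move=> hk; apply: le_trans (ler_norm_sum _ _ _) _.
have [P0 P1] := P_dist s.
rewrite -[leRHS]mul1r -P1 mulr_suml; apply: ler_sum => y _.
by rewrite normrM (ger0_norm (P0 y)) ler_wpM2l.
Qed.

Lemma iter_app_le (h : S -> R) (k : R) (t : nat) (s : S) :
  (forall y, `|h y| <= k) -> `|iter t app h s| <= k.
Proof. by move=> hk; elim: t s => //= t IH s; exact: app_le. Qed.

Lemma discounted_cvg (u : nat -> R) (k : R) : (forall t, `|u t| <= k) ->
  cvgn (series (fun t => gam ^+ t * u t)).
Proof.
move=> uk; have k0 : 0 <= k := le_trans (normr_ge0 _) (uk 0).
apply: normed_cvg; apply: (@series_le_cvg _ _ (geometric k gam)) => [t|t|t|].
- exact: normr_ge0.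
- by apply: mulr_ge0 => //; apply: exprn_ge0; exact: ltW.
- rewrite /= normrM normrX (gtr0_norm gam_gt0).
  by rewrite mulrC ler_wpM2r// exprn_ge0 ?ltW.
- by exact: is_cvg_geometric_series.
Qed.

Lemma discounted_le (u : nat -> R) (k : R) (n : nat) : (forall t, `|u t| <= k) ->
  `|series (fun t => gam ^+ t * u t) n| <= k / (1 - gam).
Proof.
move=> uk; have k0 : 0 <= k := le_trans (normr_ge0 _) (uk 0).
apply: le_trans (ler_norm_sum _ _ _) _.
apply: le_trans (geometric_le_lim n k0 gam_gt0 gam_lt1).
apply: ler_sum => t _; rewrite normrM normrX (gtr0_norm gam_gt0).
by rewrite mulrC ler_wpM2r// exprn_ge0 ?ltW.
Qed.

Lemma bounded_fin (I : finType) (h : I -> R) : exists k, forall y, `|h y| <= k.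
Proof.
exists (\sum_y `|h y|) => y; rewrite (bigD1 y)//= lerDl.
by apply: sumr_ge0.
Qed.

Lemma resolvent_cvg (h : S -> R) (s : S) :
  series (fun t => gam ^+ t * iter t app h s) @ \oo --> resolvent h s.
Proof.
by have [k hk] := bounded_fin h; apply: (@discounted_cvg _ k) => t; exact: iter_app_le.
Qed.

Lemma resolventE (h : S -> R) (s : S) :
  resolvent h s = h s + gam * app (resolvent h) s.
Proof.
pose u s n := series (fun t => gam ^+ t * iter t app h s) n.
have step n : u s n.+1 = h s + gam * \sum_y P s y * u y n.
  rewrite /u /series /= big_nat_recl//= expr0 mul1r; congr (_ + _).
  rewrite mulr_sumr.
  under eq_bigr do rewrite {1}/app mulr_sumr.
  rewrite exchange_big/=; apply: eq_bigr => y _.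
  by rewrite !mulr_sumr; apply: eq_bigr => t _; rewrite exprS; ring.
have l1 : u s n.+1 @[n --> \oo] --> resolvent h s.
  by rewrite (cvg_shiftS (u s)); exact: resolvent_cvg.
have l2 : u s n.+1 @[n --> \oo] --> h s + gam * app (resolvent h) s.
  under eq_fun do rewrite step.
  apply: cvgD; first exact: cvg_cst.
  apply: cvgMl_tmp; apply: cvg_sumr => y; apply: cvgMl_tmp.
  exact: resolvent_cvg.
exact: (cvg_unique _ l1 l2).
Qed.

(** At a state where [|w|] is maximal, [|w s| <= k + gam * |w s|]. The case [k = 0] is uniqueness
    for the Bellman equation. *)
Lemma contraction_le (w z : S -> R) (k : R) :
  (forall s, w s = z s + gam * app w s) -> (forall s, `|z s| <= k) ->
  forall s, `|w s| <= k / (1 - gam).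
Proof.
move=> wE zk s0; have g1 : 0 < 1 - gam by rewrite subr_gt0; case/andP: gam_range.
have [s hs] : exists s, forall y, `|w y| <= `|w s|.
  pose m := [arg max_(s > s0) `|w s|]%O; exists m => y.
  by rewrite /m; case: arg_maxP => // i _; apply.
apply: le_trans (hs s0) _; rewrite ler_pdivlMr//.
have := app_le s hs; have := zk s; have := ler_normD (z s) (gam * app w s).
rewrite -wE normrM (gtr0_norm gam_gt0).
move=> h1 h2 h3; have : gam * `|app w s| <= gam * `|w s| by rewrite ler_wpM2l// ltW.
lra.
Qed.

Lemma resolvent_le (h : S -> R) (k : R) (s : S) :
  (forall y, `|h y| <= k) -> `|resolvent h s| <= k / (1 - gam).
Proof. by move=> hk; apply: (contraction_le (resolventE h)). Qed.

Lemma appD (h1 h2 : S -> R) (k : R) (s : S) :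
  app (fun y => h1 y + k * h2 y) s = app h1 s + k * app h2 s.
Proof.
by rewrite /app mulr_sumr -big_split/=; apply: eq_bigr => y _; ring.
Qed.

Lemma resolventD (h1 h2 : S -> R) (k : R) (s : S) :
  resolvent (fun y => h1 y + k * h2 y) s = resolvent h1 s + k * resolvent h2 s.
Proof.
pose w s := resolvent (fun y => h1 y + k * h2 y) s
  + (-1) * (resolvent h1 s + k * resolvent h2 s).
suff /(_ s) : forall s, `|w s| <= 0 / (1 - gam).
  by rewrite mul0r normr_le0 /w => /eqP; lra.
apply: (@contraction_le w (fun _ => 0)) => [y|y]; last by rewrite normr0.
rewrite /w appD appD {1}resolventE {1}(resolventE h1) {1}(resolventE h2); ring.
Qed.

End Resolvent.

(** * The value as a resolvent *)

Lemma sum_pairE (R : realType) (I J : finType) (F : I * J -> R) :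
  \sum_z F z = \sum_i \sum_j F (i, j).
Proof. by rewrite pair_bigA; apply: eq_bigr => -[]. Qed.

(** * Expectations of finitely valued functions *)

Section Simple.
Context d (T : measurableType d) (R : realType) (P : probability T R).

Definition prb (B : set T) : R := fine (P B).

Lemma prbE (B : set T) : measurable B -> P B = (prb B)%:E.
Proof. by move=> mB; rewrite /prb fineK// fin_num_measure. Qed.

Lemma integral_simple (I : finType) (c : I -> R) (B : I -> set T) :
  (forall i, measurable (B i)) ->
  (\int[P]_w (\sum_i c i * \1_(B i) w)%:E = (\sum_i c i * prb (B i))%:E)%E.
Proof.
move=> mB.
under eq_integral do rewrite -sumEFin.
rewrite integral_sum//; last first.
  move=> i; under eq_fun do rewrite EFinM; apply: integrableZl => //.
  exact: integrable_indic.
rewrite -sumEFin; apply: eq_bigr => i _.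
under eq_integral do rewrite EFinM.
rewrite integralZl//; last exact: integrable_indic.
by rewrite integral_indic// setIT EFinM; congr (_ * _)%E; exact: prbE.
Qed.

Lemma sum_indic_fiber (I : finType) (Z : T -> I) (h : I -> R) (w : T) :
  \sum_z h z * \1_(Z @^-1` [set z]) w = h (Z w).
Proof.
rewrite (bigD1 (Z w))//= indicE mem_set//= mulr1 big1 ?addr0// => z zw.
by rewrite indicE memNset ?mulr0//= => /esym/eqP; rewrite (negbTE zw).
Qed.

Lemma prb_partition (I : finType) (Z : T -> I) (E : set T) :
  (forall z, measurable (Z @^-1` [set z])) -> measurable E ->
  prb E = \sum_z prb (E `&` Z @^-1` [set z]).
Proof.
move=> mZ mE; apply: EFin_inj; rewrite -prbE//.
have mI z : measurable (E `&` Z @^-1` [set z]) by exact: measurableI.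
under [in RHS]eq_bigr do rewrite -[prb _]mul1r.
rewrite -(integral_simple (fun _ => 1) mI).
rewrite -[in LHS](setIT E) -integral_indic//.
apply: eq_integral => w _; congr (_%:E).
under eq_bigr do rewrite indicI mul1r /=.
by rewrite -mulr_sumr; under eq_bigr do rewrite -[\1__ _]mul1r;
  rewrite sum_indic_fiber mulr1.
Qed.

End Simple.

(** * Marginals of the trajectory and the expected return *)

Section Trajectory.
Context (R : realType) (S A : finType) (M : mdp R S A).
Context (d : measure_display) (Omega : measurableType d).
Context (Pr : (S -> A -> R) -> S -> probability Omega R).
Context (St : nat -> Omega -> S) (At : nat -> Omega -> A).
Hypothesis hproc : trajectory_process M Pr St At.
Context (pi : S -> A -> R) (hpi : is_policy pi) (s : S).

Let P := Pr pi s.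
Let Z (t : nat) (w : Omega) : S * A := (St t w, At t w).
Let step (z z' : S * A) : R := trans M z.1 z.2 z'.1 * pi z'.1 z'.2.

Let mZ (t : nat) (z : S * A) : measurable (Z t @^-1` [set z]).
Proof.
rewrite (_ : _ @^-1` _ = St t @^-1` [set z.1] `&` At t @^-1` [set z.2]).
  apply: measurableI; [exact: measurable_state hproc _ _|].
  exact: measurable_action hproc _ _.
apply/seteqP; split => w /=; first by move=> <-.
by rewrite /Z; case: z => x a /= [-> ->].
Qed.

(** The law is given on full histories from time 0; windows starting at a later time lead from it to
    the one-step marginals. *)
Let window (k n : nat) (c : nat -> S * A) : set Omega :=
  [set w | forall t, (k <= t)%N -> (t <= n)%N -> Z t w = c t].

Let window_measurable (k n : nat) (c : nat -> S * A) : measurable (window k n c).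
Proof.
rewrite (_ : window k n c =
  \bigcap_(t in [set t | (k <= t)%N /\ (t <= n)%N]) (Z t @^-1` [set c t])).
  by apply: bigcap_measurableType => t _; exact: mZ.
by apply/seteqP; split=> w /= H t; [case; exact: H|move=> ? ?; exact: H].
Qed.

Let window_law (n : nat) (c : nat -> S * A) : prb P (window 0 n c) =
  ((c 0%N).1 == s)%:R * (\prod_(t < n.+1) pi (c t).1 (c t).2)
    * \prod_(t < n) trans M (c t).1 (c t).2 (c t.+1).1.
Proof.
apply: EFin_inj; rewrite -prbE//.
rewrite -(trajectory_law hproc s hpi n (fun t => (c t).1) (fun t => (c t).2)).
congr (P _); apply/seteqP; split=> w /= H t.
  by move=> tn; rewrite -(H t)//.
move=> _ tn; have [h1 h2] := H t tn.
by rewrite /Z h1 h2; case: (c t).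
Qed.

(* Memory before time [k] is summed out one step at a time. *)
Let window_step (k n : nat) (c : nat -> S * A) : (k <= n)%N ->
  prb P (window k n.+1 c) = prb P (window k n c) * step (c n) (c n.+1).
Proof.
elim: k c => [|k IH] c kn.
  by rewrite !window_law big_ord_recr/= [in X in _ * X = _]big_ord_recr /step/=; ring.
(* [cz z] prescribes [z] at time [k]; summing over [z] frees that time and leaves a window that
   starts at [k.+1]. *)
pose cz z t := if t == k then z else c t.
have split N : (k < N)%N -> prb P (window k.+1 N c) = \sum_z prb P (window k N (cz z)).
  move=> kN; rewrite (@prb_partition _ _ _ P _ (Z k))//.
  apply: eq_bigr => z _; congr (prb P _); apply/seteqP; split=> w /=.
    move=> [H Hk] t kt tN; rewrite /cz; case: eqP => [->//|/eqP tk].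
    by apply: H => //; rewrite ltn_neqAle eq_sym tk.
  move=> H; split; last by have := H k (leqnn k) (ltnW kN); rewrite /cz eqxx.
  by move=> t kt tN; have := H t (ltnW kt) tN; rewrite /cz gtn_eqF.
rewrite !split//; last exact: ltnW.
rewrite mulr_suml; apply: eq_bigr => z _; rewrite IH; last exact: ltnW.
by rewrite /cz !gtn_eqF// ltnW.
Qed.

Let marg (t : nat) (z : S * A) : R := prb P (Z t @^-1` [set z]).

Let marg0 (z : S * A) : marg 0 z = (z.1 == s)%:R * pi z.1 z.2.
Proof.
have := window_law 0 (fun _ => z); rewrite big_ord1 big_ord0 mulr1 => <-.
congr (prb P _); apply/seteqP; split => w /=; last exact.
by move=> H t _; rewrite leqn0 => /eqP ->.
Qed.

(** The Chapman-Kolmogorov equation, read off from [window_step] for the window made of [t] and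
    [t.+1] only. *)
Let margS (t : nat) (z' : S * A) :
  marg t.+1 z' = \sum_z marg t z * step z z'.
Proof.
rewrite /marg (@prb_partition _ _ _ P _ (Z t))//; apply: eq_bigr => z _.
pose c k := if k == t.+1 then z' else z.
have := @window_step t t c (leqnn t); rewrite /c eqxx ltn_eqF// => E.
transitivity (prb P (window t t.+1 c)).
  congr (prb P _); apply/seteqP; split=> w /=.
    move=> [h1 h2] k tk kt; rewrite /c; case: eqP => [->//|/eqP kt'].
    by rewrite (_ : k = t)//; apply/eqP; rewrite eqn_leq tk -ltnS ltn_neqAle kt' kt.
  move=> H; split; first by have := H t.+1 (leqnSn t) (leqnn _); rewrite /c eqxx.
  by have := H t (leqnn _) (leqnSn t); rewrite /c ltn_eqF.
rewrite E; congr (prb P _ * _); apply/seteqP; split=> w /=.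
  by move=> H; have := H t (leqnn _) (leqnn _); rewrite ltn_eqF.
move=> H k tk kt; have -> : k = t by apply/eqP; rewrite eqn_leq tk kt.
by rewrite ltn_eqF.
Qed.

Definition policy_trans (x y : S) : R := \sum_a pi x a * trans M x a y.

Lemma policy_trans_dist (x : S) : is_dist (policy_trans x).
Proof.
have [p0 p1] := hpi x; split=> [y|].
  by apply: sumr_ge0 => a _; apply: mulr_ge0 => //; case: (trans_dist M x a).
rewrite /policy_trans exchange_big/= -p1; apply: eq_bigr => a _.
by rewrite -mulr_sumr; case: (trans_dist M x a) => _ ->; rewrite mulr1.
Qed.

Definition policy_mean (h : S * A -> R) (x : S) : R := \sum_a pi x a * h (x, a).

(** The induction keeps [h] general: the last transition is integrated out first, replacing [h] by
    its one-step expectation, whose policy mean is [app policy_trans (policy_mean h)]. *)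
Let marg_mean (t : nat) (h : S * A -> R) :
  \sum_z marg t z * h z = iter t (app policy_trans) (policy_mean h) s.
Proof.
elim: t h => [|t IH] h.
  under eq_bigr do rewrite marg0.
  rewrite sum_pairE/=.
  rewrite (bigD1 s)//= [X in _ + X]big1 ?addr0.
    by apply: eq_bigr => a _; rewrite eqxx mul1r.
  by move=> x /negbTE ->; apply: big1 => a _; rewrite !mul0r.
rewrite iterSr -[RHS](_ : \sum_z marg t z * (\sum_z' step z z' * h z') = _).
  under eq_bigr do rewrite margS mulr_suml.
  rewrite exchange_big/=; apply: eq_bigr => z _; rewrite mulr_sumr.
  by apply: eq_bigr => z' _; rewrite mulrA.
rewrite IH; congr (iter t _ _ s); apply/funext => x.
rewrite /policy_mean /app /policy_trans.
under [RHS]eq_bigr do rewrite mulr_suml.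
rewrite exchange_big/=; apply: eq_bigr => a _.
rewrite sum_pairE mulr_sumr.
apply: eq_bigr => y _; rewrite mulr_sumr mulr_sumr.
by apply: eq_bigr => b _; rewrite /step/=; ring.
Qed.

Context (lam : R) (f : R -> R) (piref : S -> A -> R).

Definition step_reward (z : S * A) : R :=
  reward M z.1 z.2 - lam * fdiv f (pi z.1) (piref z.1).

Let gam := disc M.
Let gI : 0 < gam < 1 := disc_range M.

(** The truncated returns [F n] are simple functions whose expectations are the partial sums of the
    resolvent. They are dominated by the constant [k / (1 - gam)], so dominated convergence passes
    to the limit. *)
Lemma value_resolvent : value M Pr St At lam f piref pi s =
  resolvent gam policy_trans (policy_mean step_reward) s.
Proof.
pose F n w := series (fun t => gam ^+ t * step_reward (Z t w)) n.
have [k hk] := bounded_fin step_reward.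
pose B := k / (1 - gam).
have intF n : (\int[P]_w (F n w)%:E)%E =
    (series (fun t => gam ^+ t * iter t (app policy_trans) (policy_mean step_reward) s) n)%:E.
  (* Indexing by time and value together writes the truncated return as one finite combination of
     indicators. *)
  pose c (i : 'I_n * (S * A)) := gam ^+ i.1 * step_reward i.2.
  pose E (i : 'I_n * (S * A)) := Z i.1 @^-1` [set i.2].
  have mE i : measurable (E i) by exact: mZ.
  transitivity (\int[P]_w (\sum_i c i * \1_(E i) w)%:E)%E.
    apply: eq_integral => w _; congr (_%:E).
    rewrite sum_pairE.
    rewrite /F /series/= big_mkord; apply: eq_bigr => t _.
    under [RHS]eq_bigr do rewrite /c /E /= -mulrA.
    by rewrite -mulr_sumr sum_indic_fiber.
  rewrite integral_simple//; congr (_%:E).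
  rewrite sum_pairE.
  rewrite /series/= big_mkord; apply: eq_bigr => t _.
  rewrite -marg_mean mulr_sumr; apply: eq_bigr => z _.
  by rewrite /c /E /marg /= -mulrA [step_reward z * _]mulrC.
have mF n : measurable_fun setT (F n).
  apply: measurable_sum => t; apply: measurable_funM; first exact: measurable_cst.
  rewrite (_ : (fun w => _) = (fun w => \sum_z step_reward z * \1_(Z t @^-1` [set z]) w)).
    apply: measurable_sum => z; apply: measurable_funM; first exact: measurable_cst.
    by apply: measurable_indic; exact: mZ.
  by apply/funext => w; rewrite sum_indic_fiber.
have cF w : F n w @[n --> \oo] --> reg_return M lam f piref pi St At w.
  exact: (@discounted_cvg _ _ gI _ k).
have mlim : measurable_fun setT (reg_return M lam f piref pi St At).
  by apply: (@measurable_fun_cvg _ _ _ _ F) => // w _; exact: cF.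
have h1 n : measurable_fun setT (fun w => (F n w)%:E) by exact/measurable_EFinP.
have h2 : measurable_fun setT (EFin \o reg_return M lam f piref pi St At).
  exact/measurable_EFinP.
have h3 : {ae P, forall w, [set: Omega] w -> (F n w)%:E @[n --> \oo] -->
    (EFin \o reg_return M lam f piref pi St At) w}.
  by apply: aeW => w _; apply: cvg_EFin; [exact: nearW|exact: cF].
have h4 : P.-integrable setT (EFin \o cst B) by exact: finite_measure_integrable_cst.
have h5 : {ae P, forall w n, [set: Omega] w ->
    (`|(F n w)%:E| <= (EFin \o cst B) w)%E}.
  apply: aeW => w n _; rewrite /= lee_fin.
  exact: discounted_le.
have [_ _ H] := dominated_convergence measurableT h1 h2 h3 h4 h5.
rewrite /value unlock -/P.
have H' : (\int[P]_w (F n w)%:E)%E @[n --> \oo] -->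
    (resolvent gam policy_trans (policy_mean step_reward) s)%:E.
  rewrite (funext intF); apply: cvg_EFin; first exact: nearW.
  exact: (resolvent_cvg gI policy_trans_dist).
by rewrite (cvg_unique _ H H').
Qed.

End Trajectory.

(** * Perturbation of the value *)

Section Perturbation.
Context (R : realType) (S A : finType) (M : mdp R S A) (lam : R).
Hypothesis lam_gt0 : 0 < lam.
Let gam := disc M.
Let gI : 0 < gam < 1 := disc_range M.
Let gam_gt0 : 0 < gam. Proof. by case/andP: gI. Qed.
Let gam_lt1 : 0 < 1 - gam. Proof. by rewrite subr_gt0; case/andP: gI. Qed.

Definition reg_reward (pi : S -> A -> R) (D : S -> R) (s : S) : R :=
  \sum_a pi s a * reward M s a - lam * D s.

Definition reg_value (pi : S -> A -> R) (D : S -> R) : S -> R :=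
  resolvent gam (policy_trans M pi) (reg_reward pi D).

Definition qvalue (v : S -> R) (s : S) (a : A) : R :=
  reward M s a + gam * \sum_y trans M s a y * v y.

(** The solution of the linearized Bellman equation: the increments of policy and divergence enter
    as a one-step source, and propagation uses the unperturbed policy. *)
Definition dvalue (pi : S -> A -> R) (D : S -> R) (dpi : S -> A -> R)
    (dD : S -> R) : S -> R :=
  resolvent gam (policy_trans M pi)
    (fun s => \sum_a dpi s a * qvalue (reg_value pi D) s a - lam * dD s).

Lemma app_policy_trans (pi : S -> A -> R) (h : S -> R) (s : S) :
  app (policy_trans M pi) h s = \sum_a pi s a * \sum_y trans M s a y * h y.
Proof.
rewrite /app /policy_trans; under eq_bigr do rewrite mulr_suml.
rewrite exchange_big/=; apply: eq_bigr => a _; rewrite mulr_sumr.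
by apply: eq_bigr => y _; rewrite mulrA.
Qed.

Lemma reg_valueE (pi : S -> A -> R) (D : S -> R) (s : S) : is_policy pi ->
  reg_value pi D s = \sum_a pi s a * qvalue (reg_value pi D) s a - lam * D s.
Proof.
move=> hpi; rewrite {1}/reg_value resolventE//; last exact: policy_trans_dist.
rewrite -/(reg_value pi D) app_policy_trans /reg_reward /qvalue.
under [in RHS]eq_bigr do rewrite mulrDr.
rewrite big_split/= mulr_sumr.
under [X in _ + X = _]eq_bigr do rewrite mulrCA.
by rewrite addrAC.
Qed.

Context (pi pi' : S -> A -> R) (D D' : S -> R) (dpi : S -> A -> R) (dD : S -> R).
Hypotheses (hpi : is_policy pi) (hpi' : is_policy pi').
Context (C B D1 E df : R).
Hypothesis D_le : forall s, `|D s| <= df.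
Hypothesis pi_lip : forall s, \sum_a `|pi' s a - pi s a| <= C.
Hypothesis pi_lin : forall s, \sum_a `|pi' s a - pi s a - dpi s a| <= B.
Hypothesis D_lip : forall s, `|D' s - D s| <= D1.
Hypothesis D_lin : forall s, `|D' s - D s - dD s| <= E.

Let v := reg_value pi D.
Let v' := reg_value pi' D'.
Let l := dvalue pi D dpi dD.
Let k := 1 + lam * df.
Let q := 1 + gam * (k / (1 - gam)).

Let sum_pairing_le (w h : A -> R) (x y : R) : 0 <= y ->
  \sum_a `|w a| <= x -> (forall a, `|h a| <= y) -> `|\sum_a w a * h a| <= x * y.
Proof.
move=> y0 hx hy; apply: le_trans (ler_norm_sum _ _ _) _.
apply: le_trans (ler_wpM2r y0 hx); rewrite mulr_suml; apply: ler_sum => a _.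
by rewrite normrM ler_wpM2l.
Qed.

Let next_le (h : S -> R) (y : R) (s : S) (a : A) : (forall z, `|h z| <= y) ->
  `|\sum_z trans M s a z * h z| <= y.
Proof. exact: (@app_le _ _ (fun=> trans M s a) (fun=> trans_dist M s a)). Qed.

Let k_ge0 (s : S) : 0 <= k.
Proof.
rewrite /k addr_ge0// mulr_ge0 ?(ltW lam_gt0)//.
exact: le_trans (normr_ge0 _) (D_le s).
Qed.

Let q_ge0 (s : S) : 0 <= q.
Proof.
by rewrite /q addr_ge0// mulr_ge0 ?(ltW gam_gt0)// divr_ge0 ?(k_ge0 s)// ltW.
Qed.

Let v_le (s : S) : `|v s| <= k / (1 - gam).
Proof.
apply: (resolvent_le gI (policy_trans_dist M hpi)) => y.
apply: le_trans (ler_normB _ _) _; apply: lerD; last first.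
  by rewrite normrM (gtr0_norm lam_gt0) ler_wpM2l// ltW.
have [p0 p1] := hpi y; rewrite -[leRHS]mulr1; apply: sum_pairing_le => // [|a].
  by under eq_bigr => a _ do rewrite (ger0_norm (p0 a)); rewrite p1.
by have /andP[r0 r1] := reward_range M y a; rewrite ger0_norm.
Qed.

Let qvalue_le (s : S) (a : A) : `|qvalue v s a| <= q.
Proof.
apply: le_trans (ler_normD _ _) _; apply: lerD.
  by have /andP[r0 r1] := reward_range M s a; rewrite ger0_norm.
by rewrite normrM (gtr0_norm gam_gt0) ler_wpM2l ?(ltW gam_gt0)//; exact: next_le.
Qed.

(** A performance difference identity: the source involves only the old value [v], and the new
    policy does the propagation. *)
Let diff_eq (s : S) : v' s - v s =
  (\sum_a (pi' s a - pi s a) * qvalue v s a - lam * (D' s - D s))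
  + gam * app (policy_trans M pi') (fun y => v' y - v y) s.
Proof.
rewrite /v /v' !reg_valueE// -/v -/v' app_policy_trans.
under [\sum_a (pi' s a - _) * _]eq_bigr do rewrite mulrBl.
rewrite sumrB.
have -> : \sum_a pi' s a * qvalue v' s a = \sum_a pi' s a * qvalue v s a
    + gam * \sum_a pi' s a * (\sum_y trans M s a y * (v' y - v y)).
  rewrite mulr_sumr -big_split/=; apply: eq_bigr => a _; rewrite /qvalue.
  by under [in RHS]eq_bigr do rewrite mulrBr; rewrite sumrB; ring.
ring.
Qed.

Let diff_le (s : S) : `|v' s - v s| <= (C * q + lam * D1) / (1 - gam).
Proof.
apply: (contraction_le gI (policy_trans_dist M hpi') diff_eq) => y.
apply: le_trans (ler_normB _ _) _; apply: lerD.
  exact: (sum_pairing_le (q_ge0 s)).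
by rewrite normrM (gtr0_norm lam_gt0) ler_wpM2l ?(ltW lam_gt0).
Qed.

Let lE (s : S) : l s = \sum_a dpi s a * qvalue v s a - lam * dD s
  + gam * app (policy_trans M pi) l s.
Proof. by rewrite {1}/l /dvalue (resolventE gI (policy_trans_dist M hpi)). Qed.

(** The error propagates under [pi], whereas [v' - v] propagates under [pi']. The exchange costs
    [gam * C] times the bound on [v' - v], a product of two first-order quantities. *)
Lemma value_linearize (s : S) : `|v' s - v s - l s| <=
  (B * q + lam * E + gam * (C * ((C * q + lam * D1) / (1 - gam)))) / (1 - gam).
Proof.
pose z s := (\sum_a (pi' s a - pi s a - dpi s a) * qvalue v s a
    - lam * (D' s - D s - dD s))
  + gam * \sum_a (pi' s a - pi s a) * \sum_y trans M s a y * (v' y - v y).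
apply: (@contraction_le _ _ _ _ gI (policy_trans_dist M hpi)
  (fun y => v' y - v y - l y) z) => y; last first.
  apply: le_trans (ler_normD _ _) _; apply: lerD.
    apply: le_trans (ler_normB _ _) _; apply: lerD.
      exact: (sum_pairing_le (q_ge0 y)).
    by rewrite normrM (gtr0_norm lam_gt0) ler_wpM2l ?(ltW lam_gt0).
  rewrite normrM (gtr0_norm gam_gt0) ler_wpM2l ?(ltW gam_gt0)//.
  apply: sum_pairing_le => // [|a]; first exact: le_trans (normr_ge0 _) (diff_le y).
  exact: next_le.
rewrite diff_eq lE /z.
have -> : app (policy_trans M pi) (fun y => v' y - v y - l y) y =
    app (policy_trans M pi) (fun y => v' y - v y) y - app (policy_trans M pi) l y.
  by rewrite /app -sumrB; apply: eq_bigr => x _; ring.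
rewrite !app_policy_trans.
under [\sum_a (_ - dpi y a) * _]eq_bigr do rewrite mulrBl.
under [\sum_a (_ - pi y a) * (\sum_y _)]eq_bigr do rewrite mulrBl.
by rewrite !sumrB; ring.
Qed.

End Perturbation.

Lemma dvalueD (R : realType) (S A : finType) (M : mdp R S A) (lam : R)
    (pi : S -> A -> R) (D : S -> R) (dpi dpi' : S -> A -> R) (dD dD' : S -> R)
    (k : R) (s : S) : is_policy pi ->
  dvalue M lam pi D (fun s a => dpi s a + k * dpi' s a) (fun s => dD s + k * dD' s) s
  = dvalue M lam pi D dpi dD s + k * dvalue M lam pi D dpi' dD' s.
Proof.
move=> hpi; rewrite /dvalue -(resolventD (disc_range M) (policy_trans_dist M hpi)).
congr (resolvent _ _ _ s); apply/funext => y.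
under eq_bigr do rewrite mulrDl -mulrA.
by rewrite big_split/= -mulr_sumr; ring.
Qed.

(** * Smoothness of the value *)

Section Constants.
Context (R : realType) (f : R -> R) (pmin omega kappa : R) (g1 g2 g3 : R -> R).
Hypotheses (g1E : g1 = derive1 f) (g2E : g2 = derive1n 2 f)
  (g3E : g3 = derive1n 3 f).
Hypotheses (pmin_gt0 : 0 < pmin) (hA : assumption_A pmin f omega kappa).
Context (S A : finType) (piref : S -> A -> R).
Hypotheses (piref_policy : is_policy piref) (hP : assumption_P pmin piref).

Let ref_gt0 (s : S) (a : A) : 0 < piref s a := lt_trans pmin_gt0 (hP s a).

Lemma fdiv_le_d_const (s : S) (nu : A -> R) :
  is_dist nu -> fdiv f nu (piref s) <= d_const f piref.
Proof.
move=> hnu; apply: ub_le_sup; last by exists s, nu.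
have [B hB] := A_bounded hA.
exists B => _ [s' [mu hmu ->]].
have [_ q1] := piref_policy s'; rewrite -[leRHS]mul1r -q1 mulr_suml.
apply: ler_sum => a _; rewrite ler_wpM2l ?(ltW (ref_gt0 _ _))//.
apply: le_trans (ler_norm _) (hB _ _); apply/andP; split.
  by have [mu0 _] := hmu; rewrite divr_ge0// ltW.
by apply/ltW/(ratio_lt pmin_gt0 (hP s')); exact: dist_le1.
Qed.

(** Sum the tangent inequality of [f] at 1 against the reference: the linear part vanishes because
    both masses are 1. Hence [d_const] also bounds the absolute value of the divergence. *)
Lemma fdiv_ge0 (s : S) (nu : A -> R) : is_dist nu -> (forall a, 0 < nu a) ->
  0 <= fdiv f nu (piref s).
Proof.
move=> hnu nu0; have [_ q1] := piref_policy s; have [_ nu1] := hnu.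
apply: (@le_trans _ _ (\sum_a g1 1 * (nu a - piref s a))).
  by rewrite -mulr_sumr sumrB nu1 q1 subrr mulr0.
apply: ler_sum => a _; have q0 := ref_gt0 s a.
have h := gen_tangent g1E g2E hA (one_lt_pminV pmin_gt0 (piref_policy s) (hP s) a)
  (ratio_gt0 pmin_gt0 (hP s) a (nu0 a) (dist_le1 a hnu)).
have -> : g1 1 * (nu a - piref s a) = piref s a * (g1 1 * (nu a / piref s a - 1)).
  by field; rewrite gt_eqF.
by rewrite ler_wpM2l// ltW.
Qed.

Lemma der_ratio_le_y_const (s : S) (nu : A -> R) :
  is_dist nu -> (forall a, 0 < nu a) ->
  \sum_a piref s a * (`|g1 (nu a / piref s a)| / g2 (nu a / piref s a))
    <= y_const f piref.
Proof.
move=> hnu nu0; apply: ub_le_sup; last first.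
  exists s, nu => //; apply: eq_bigr => a _.
  by rewrite /der_ratio ifN ?g1E ?g2E// gt_eqF// divr_gt0.
(* As [piref] exceeds [pmin], the largest ratio [1 / piref s a] is strictly inside the domain, where
   [der_ratio_bounded] applies. *)
have /choice[B hB] : forall sa : S * A, exists B : R, forall u : R,
    0 <= u <= 1 / piref sa.1 sa.2 -> `|der_ratio f u| <= B.
  move=> [s' a]; apply: (der_ratio_bounded g1E g2E g3E pmin_gt0 hA).
  exact: (ratio_gt0 pmin_gt0 (hP s') a ltr01 (lexx 1)).
exists (\sum_s' \sum_a piref s' a * `|B (s', a)|) => _ [s' [mu hmu ->]].
rewrite [leRHS](bigD1 s')//= ler_wpDr//.
  by apply: sumr_ge0 => y _; apply: sumr_ge0 => a _; rewrite mulr_ge0// ltW.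
apply: ler_sum => a _; have q0 := ref_gt0 s' a.
rewrite ler_wpM2l ?(ltW q0)//; apply: le_trans (ler_norm _) _.
apply: le_trans (ler_norm (B (s', a))); apply: hB => /=.
have [mu0 _] := hmu; rewrite divr_ge0 ?(ltW q0)//=.
by rewrite ler_wpM2r ?invr_ge0 ?(ltW q0)// dist_le1.
Qed.

End Constants.

(* With [i = 1 / (1 - g)], [1 + g * i = i]; the two sides then differ by
   [3/2 * lam * i * (om + kap * y) * m ^ 2]. *)
Lemma L_const_bound (R : realType) (g lam om kap df y m : R) :
  0 < 1 - g -> 0 < lam -> 0 <= om -> 0 <= kap -> 0 <= y ->
  forall q C : R, q = 1 + g * ((1 + lam * df) / (1 - g)) -> C = 2 * om * m ->
  (4 * kap * om * m ^+ 2 * q + lam * ((om + 5 * kap * y) / 2 * m ^+ 2)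
    + g * (C * ((C * q + lam * (2 * m * y)) / (1 - g)))) / (1 - g)
  <= L_const g lam om kap df y / 2 * m ^+ 2.
Proof.
move=> g0 lam0 om0 kap0 y0 q C -> ->; rewrite -subr_ge0 /L_const.
rewrite [leRHS](_ : _ = 3 / 2 * lam * (om + kap * y) * m ^+ 2 / (1 - g)).
  apply: divr_ge0; last exact: ltW.
  apply: mulr_ge0; last exact: sqr_ge0.
  apply: mulr_ge0; last by rewrite addr_ge0// mulr_ge0.
  by apply: mulr_ge0; [exact: divr_ge0|exact: ltW].
by field; rewrite gt_eqF.
Qed.

Lemma norm2_sqr (R : realType) (S A : finType) (u : S -> A -> R) :
  norm2 u ^+ 2 = inner u u.
Proof.
rewrite sqr_sqrtr//; apply: sumr_ge0 => s _; apply: sumr_ge0 => a _.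
by rewrite -expr2 sqr_ge0.
Qed.

Lemma le_norm2 (R : realType) (S A : finType) (u : S -> A -> R) (s : S) (a : A) :
  `|u s a| <= norm2 u.
Proof.
rewrite -sqrtr_sqr ler_wsqrtr// /inner (bigD1 s)//= (bigD1 a)//= -expr2 -addrA lerDl.
apply: addr_ge0; apply: sumr_ge0 => ? _; last apply: sumr_ge0 => ? _.
all: by rewrite -expr2 sqr_ge0.
Qed.

Lemma linear_at0 (R : realType) (S A : finType) (l : (S -> A -> R) -> R) :
  (forall (u v : S -> A -> R) (k : R), l (fun s a => u s a + k * v s a) = l u + k * l v) ->
  l (fun _ _ => 0) = 0.
Proof.
move=> lin; pose z : S -> A -> R := fun _ _ => 0.
have zE : (fun s a => z s a + 1 * z s a) = z.
  by apply/funext => s; apply/funext => a; rewrite mulr0 addr0.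
have := lin z z 1; rewrite zE -/z; lra.
Qed.

(** Used to identify the linear map [dV th] with the pairing against its values on coordinate
    vectors, which are the partial derivatives. *)
Lemma linear_expand (R : realType) (S A : finType) (l : (S -> A -> R) -> R)
    (u : S -> A -> R) :
  (forall (u v : S -> A -> R) (k : R), l (fun s a => u s a + k * v s a) = l u + k * l v) ->
  l u = \sum_s \sum_a l (fun s' a' => ((s' == s) && (a' == a))%:R) * u s a.
Proof.
move=> lin; pose e (z : S * A) s' a' : R := ((s' == z.1) && (a' == z.2))%:R.
have l0 := linear_at0 lin.
have H (r : seq (S * A)) : l (fun s a => \sum_(z <- r) u z.1 z.2 * e z s a) =
    \sum_(z <- r) l (e z) * u z.1 z.2.
  elim: r => [|z r IH].
    rewrite big_nil -[RHS]l0; congr l.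
    by apply/funext => s; apply/funext => a; rewrite big_nil.
  rewrite big_cons -IH [l (e z) * _]mulrC addrC -lin; congr l.
  by apply/funext => s; apply/funext => a; rewrite big_cons addrC.
rewrite -(sum_pairE (fun z => l (e z) * u z.1 z.2)) -H; congr l.
apply/funext => s; apply/funext => a; rewrite (bigD1 (s, a))//= big1 ?addr0.
  by rewrite /e !eqxx mulr1.
move=> [s' a'] /= ne; rewrite /e /=; case: eqP => [E1|]; last by rewrite mulr0.
case: eqP => [E2|]; last by rewrite mulr0.
by rewrite E1 E2 eqxx in ne.
Qed.

(** * Quadratic estimate for the value and identification of its gradient *)

Section Smoothness.
Context (R : realType) (S A : finType) (M : mdp R S A).
Context (d : measure_display) (Omega : measurableType d).
Context (Pr : (S -> A -> R) -> S -> probability Omega R).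
Context (St : nat -> Omega -> S) (At : nat -> Omega -> A).
Hypothesis hproc : trajectory_process M Pr St At.
Context (lam : R) (piref : S -> A -> R) (f : R -> R) (pmin omega kappa : R).
Hypotheses (lam_gt0 : 0 < lam) (piref_policy : is_policy piref).
Hypothesis f_cvg0 : f u @[u --> 0^'+] --> f 0.
Hypotheses (pmin_gt0 : 0 < pmin) (hA : assumption_A pmin f omega kappa).
Hypothesis hP : assumption_P pmin piref.
Context (g1 g2 g3 : R -> R).
Hypotheses (g1E : g1 = derive1 f) (g2E : g2 = derive1n 2 f)
  (g3E : g3 = derive1n 3 f).

Let pol (th : S -> A -> R) : S -> A -> R := softargmax f piref th.
Let div (th : S -> A -> R) (s : S) : R := fdiv f (pol th s) (piref s).
Let V (th : S -> A -> R) : R := value_init M Pr St At lam f piref (pol th).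
Let L := L_const (disc M) lam omega kappa (d_const f piref) (y_const f piref).

Let pol_is_softargmax (th : S -> A -> R) (s : S) :
  is_softargmax f (piref s) (th s) (pol th s).
Proof.
have := softargmax_exists g1E pmin_gt0 hA f_cvg0 (piref_policy s) (hP s) (th s).
exact: xgetPex.
Qed.

Let pol_kkt (th : S -> A -> R) (s : S) : kkt g1 (piref s) (th s) (pol th s).
Proof. exact: (softargmax_kkt g1E g2E pmin_gt0 hA (hP s) f_cvg0). Qed.

Let pol_policy (th : S -> A -> R) : is_policy (pol th).
Proof. by move=> s; case: (pol_kkt th s). Qed.

Let valueE (th : S -> A -> R) : V th = \sum_s init M s * reg_value M lam (pol th) (div th) s.
Proof.
apply: eq_bigr => s _; rewrite (value_resolvent hproc)//.
congr (_ * resolvent _ _ _ s); apply/funext => x.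
rewrite /policy_mean /step_reward /reg_reward /=.
under eq_bigr do rewrite mulrBr.
by rewrite sumrB -mulr_suml; have [_ ->] := pol_policy th x; rewrite mul1r.
Qed.

Let dpol (th u : S -> A -> R) (s : S) (a : A) : R :=
  dsoftargmax g2 (piref s) (pol th s) (u s) a.

Let ddivs (th u : S -> A -> R) (s : S) : R :=
  \sum_a g1 (pol th s a / piref s a) * dpol th u s a.

Let dV (th u : S -> A -> R) : R :=
  \sum_s init M s * dvalue M lam (pol th) (div th) (dpol th u) (ddivs th u) s.

Let dV_linear (th u v : S -> A -> R) (k : R) :
  dV th (fun s a => u s a + k * v s a) = dV th u + k * dV th v.
Proof.
rewrite /dV mulr_sumr -big_split/=; apply: eq_bigr => s _.
rewrite [k * _]mulrCA -mulrDr -dvalueD//.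
have -> : dpol th (fun s a => u s a + k * v s a) =
    (fun s a => dpol th u s a + k * dpol th v s a).
  by apply/funext => x; apply/funext => a; exact: dsoftargmaxD.
congr (_ * (dvalue M lam _ _ _ _ s)).
apply/funext => x; rewrite /ddivs mulr_sumr -big_split/=; apply: eq_bigr => a _.
by rewrite /dpol dsoftargmaxD; ring.
Qed.

Let y_ge0 (s : S) : 0 <= y_const f piref.
Proof.
(* Any positive distribution would serve as a witness; this one is the softargmax at the parameter
   [piref]. *)
have [hd h0 _] := pol_kkt piref s.
apply: (le_trans _ (der_ratio_le_y_const g1E g2E g3E pmin_gt0 hA hP s hd h0)).
apply: sumr_ge0 => a _; rewrite mulr_ge0 ?divr_ge0 ?(ltW (lt_trans pmin_gt0 (hP s a)))//.
apply/ltW/(gen_der2_gt0 g1E g2E g3E pmin_gt0 hA).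
exact: (pos_ratio pmin_gt0 (hP s) a (conj hd h0)).
Qed.

Let value_quadratic (th th' u : S -> A -> R) : u = (fun s a => th' s a - th s a) ->
  `|V th' - V th - dV th u| <= L / 2 * norm2 u ^+ 2.
Proof.
move=> uE; rewrite !valueE /dV -!sumrB.
set m := norm2 u.
have om1 := gen_omega_ge1 hA.
have um (s : S) (a : A) : `|u s a| <= m by exact: le_norm2.
have [i0 i1] := init_dist M.
rewrite -[leRHS]mul1r -[X in X * _]i1 mulr_suml.
apply: le_trans (ler_norm_sum _ _ _) _; apply: ler_sum => s0 _; rewrite -!mulrBr normrM (ger0_norm (i0 s0)) ler_wpM2l//.
(* The divergence estimates are stated along a segment; this one joins [th] at 0 to [th'] at 1. *)
pose path s (al : R) := pol (fun s' a => th s' a + al * u s' a) s.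
have pk s al : kkt g1 (piref s) (fun a => th s a + al * u s a) (path s al).
  exact: (pol_kkt (fun s' a => th s' a + al * u s' a)).
have p1 s : path s 1 = pol th' s.
  rewrite /path; congr (pol _ s); apply/funext => x; apply/funext => a.
  by rewrite uE mul1r addrC subrK.
have p0 s : path s 0 = pol th s.
  by rewrite /path; congr (pol _ s); apply/funext => x; apply/funext => a;
    rewrite mul0r addr0.
have Y s (nu : A -> R) (h1 : is_dist nu) (h2 : forall a, 0 < nu a) :=
  der_ratio_le_y_const g1E g2E g3E pmin_gt0 hA hP s h1 h2.
have hD s : `|div th s| <= d_const f piref.
  have [hd h0 _] := pol_kkt th s.
  rewrite ger0_norm; first exact: (fdiv_le_d_const pmin_gt0 hA).
  exact: (fdiv_ge0 g1E g2E pmin_gt0 hA).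
have um' s a : `|th' s a - th s a| <= m by have := um s a; rewrite uE.
have hC s : \sum_a `|pol th' s a - pol th s a| <= 2 * omega * m.
  exact: (softargmax_lipschitz g1E g2E g3E pmin_gt0 hA (piref_policy s) (hP s)
    (pol_kkt th s) (pol_kkt th' s) (um' s)).
have hB s : \sum_a `|pol th' s a - pol th s a - dpol th u s a|
    <= 4 * kappa * omega * m ^+ 2.
  rewrite /dpol uE.
  exact: (softargmax_linearize g1E g2E g3E pmin_gt0 hA (piref_policy s) (hP s)
    (pol_kkt th s) (pol_kkt th' s) (um' s)).
have hD1 s : `|div th' s - div th s| <= 2 * m * y_const f piref.
  rewrite /div -p1 -p0.
  exact: (div_lipschitz g1E g2E g3E pmin_gt0 hA (piref_policy s) (hP s) (Y s)
    (um s) (pk s)).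
have hE s : `|div th' s - div th s - ddivs th u s|
    <= (omega + 5 * kappa * y_const f piref) / 2 * m ^+ 2.
  rewrite /ddivs /dpol /div -p1 -p0.
  exact: (div_linearize g1E g2E g3E pmin_gt0 hA (piref_policy s) (hP s) (Y s)
    (um s) (pk s)).
apply: le_trans (value_linearize M lam_gt0 (pol_policy th) (pol_policy th')
  hD hC hB hD1 hE s0) _.
apply: L_const_bound => //; last exact: y_ge0.
- by rewrite subr_gt0; case/andP: (disc_range M).
- exact: le_trans ler01 om1.
- exact: ltW (gen_kappa_gt0 hA).
Qed.

(** A coordinate vector has norm 1, so [value_quadratic] bounds the linearization error by
    [L / 2 * h ^+ 2], which proves existence of the partial derivative along with its value. *)
Lemma gradient_value (th : S -> A -> R) (s : S) (a : A) :
  gradient V th s a = dV th (fun s' a' => ((s' == s) && (a' == a))%:R).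
Proof.
pose e s' a' : R := ((s' == s) && (a' == a))%:R.
rewrite /gradient derive1E.
suff [_ ->] : is_derive (0 : R) 1 (fun t : R => V (fun s' a' => th s' a' + t * e s' a')) (dV th e) by [].
apply: (@is_derive_quadratic _ _ _ _ (L / 2)) => h.
(* Writing the increment as zero plus [h] times a coordinate vector matches the form of
   [dV_linear]. *)
have uE : (fun s' a' => 0 + h * e s' a') =
    (fun s' a' => (th s' a' + (0 + h) * e s' a') - (th s' a' + 0 * e s' a')).
  by apply/funext => x; apply/funext => b; ring.
have thE : (fun s' a' => th s' a' + 0 * e s' a') = th.
  by apply/funext => x; apply/funext => b; rewrite mul0r addr0.
rewrite /=; have := value_quadratic uE; rewrite thE.
have dV0 := linear_at0 (dV_linear th).
rewrite dV_linear dV0 !add0r norm2_sqr.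
rewrite (_ : inner _ _ = h ^+ 2)//.
rewrite /inner (bigD1 s)//= (bigD1 a)//= /e !eqxx/= [X in _ + X + _]big1.
  rewrite big1 => [|x xs]; first by ring.
  by apply: big1 => b _; rewrite (negbTE xs) !(mulr0, addr0).
by move=> b /negbTE ->; rewrite !(mulr0, addr0).
Qed.

Lemma value_smooth (th th' u : S -> A -> R) : u = (fun s a => th' s a - th s a) ->
  `|V th' - V th - inner (gradient V th) u| <= L / 2 * norm2 u ^+ 2.
Proof.
move=> uE; rewrite (_ : inner _ _ = dV th u); first exact: value_quadratic.
rewrite (linear_expand u (dV_linear th)).
by apply: eq_bigr => s _; apply: eq_bigr => a _; rewrite gradient_value.
Qed.

End Smoothness.

Theorem theoremB12 (R : realType) (S A : finType)
    (hS : (0 < #|S|)%N) (hA : (0 < #|A|)%N)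
    (M : mdp R S A)
    (d : measure_display) (Omega : measurableType d)
    (Pr : (S -> A -> R) -> S -> probability Omega R)
    (St : nat -> Omega -> S) (At : nat -> Omega -> A)
    (hproc : trajectory_process M Pr St At)
    (lam : R) (hlam : 0 < lam)
    (piref : S -> A -> R) (hpiref : is_policy piref)
    (f : R -> R) (hf0 : f u @[u --> 0^'+] --> f 0)
    (pmin : R) (hpmin : 0 < pmin) (omega kappa : R)
    (hAf : assumption_A pmin f omega kappa)
    (hP : assumption_P pmin piref)
    (theta theta' : S -> A -> R) :
  let v := fun th : S -> A -> R =>
    value_init M Pr St At lam f piref (softargmax f piref th) in
  let diff := fun s a => theta' s a - theta s a in
  let L := L_const (disc M) lam omega kappa
             (d_const f piref) (y_const f piref) in
  `|v theta' - v theta - inner (gradient v theta) diff|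
    <= L / 2 * norm2 diff ^+ 2.
Proof.
cbv zeta; exact: (value_smooth hproc hlam hpiref hf0 hpmin hAf hP
  erefl erefl erefl erefl).
Qed.
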